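(* The function $E:\Omega\to\mathbb{R}$ is strictly convex and coercive (the latter meaning that for every $c>0$ the set $\{\bar\xi\in\Omega : E(\bar\xi)\le c\}$ is compact), and there exists a unique self-similar solution, of the form $( * )$ given in the context, of the Stefan–Dirichlet problem. This solution corresponds to the minimum of $E$: its parameter vector $\bar\xi=(\xi_1,\ldots,\xi_m)\in\Omega$ is the (unique) point of global minimum of $E$ on $\Omega$.
   Context: Data: an integer $m\ge 1$; real numbers $u_0\le u_1<u_2<\cdots<u_m<u_{m+1}=u_D$; constants $a_i>0$, $k_i>0$ ($i=0,\ldots,m$) and $d_i\ge 0$ ($i=1,\ldots,m$), with $d_1>0$ if $u_0=u_1$. Put $F(\xi)=\frac{1}{\sqrt{\pi}}\int_0^\xi e^{-s^2/4}\,ds$, with $F(+\infty)=1$. Let $\Omega=\{\bar\xi=(\xi_1,\ldots,\xi_m)\in\mathbb{R}^m : \xi_1>\cdots>\xi_m>0\}$ and, with the conventions $\xi_0=+\infty$, $\xi_{m+1}=0$, $$E(\bar\xi)=-\sum_{i=0}^m k_i(u_{i+1}-u_i)\ln\bigl(F(\xi_i/a_i)-F(\xi_{i+1}/a_i)\bigr)+\sum_{i=1}^m \frac{d_i\xi_i^2}{4},\qquad \bar\xi\in\Omega.$$ Stefan–Dirichlet problem: find a continuous piecewise smooth function $u=u(t,x)$ on $\{t>0,\ x>0\}$ such that $u_t=a_i^2u_{xx}$ (classically) in each domain where $u_i<u<u_{i+1}$, $i=0,\ldots,m$; on each phase transition line $x=x_i(t)$ where $u=u_i$, $i=1,\ldots,m$,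 the Stefan condition $$d_i x_i'(t)+k_iu_x(t,x_i(t)+)-k_{i-1}u_x(t,x_i(t)-)=0$$ holds, where $u_x(t,x_i(t)+)$ and $u_x(t,x_i(t)-)$ are the one-sided limits on the line taken from the warmer phase (phase $i$) and from the colder phase (phase $i-1$), respectively; and $u(0,x)=u_0$ for all $x>0$, $u(t,0)=u_D$ for all $t>0$. A self-similar solution of the form $( * )$ is a solution $u=u(\xi)$, $\xi=x/\sqrt{t}$, given by $$( * )\quad u(\xi)=u_i+\frac{u_{i+1}-u_i}{F(\xi_{i+1}/a_i)-F(\xi_i/a_i)}\bigl(F(\xi/a_i)-F(\xi_i/a_i)\bigr),\quad \xi_{i+1}<\xi<\xi_i,\ i=0,\ldots,m,$$ and $u(\xi_i)=u_i$ for $i=1,\ldots,m$, for some $(\xi_1,\ldots,\xi_m)\in\Omega$ (with $\xi_0=+\infty$, $\xi_{m+1}=0$); the phase transition lines are then $x=\xi_i\sqrt{t}$, $i=1,\ldots,m$, and the initial and boundary conditions become $u(+\infty)=u_0$, $u(0)=u_D$. If $u_0=u_1$, then $u\equiv u_0$ for $\xi>\xi_1$ and the derivative from the colder side at $\xi_1$ is $0$. *)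

(* Defs.v *)
From HB Require Import structures.
From mathcomp Require Export all_boot all_order all_algebra.
From mathcomp Require Export all_classical all_reals all_analysis.

Set Implicit Arguments.
Unset Strict Implicit.
Unset Printing Implicit Defensive.

Export Order.TTheory GRing.Theory Num.Theory.
Export numFieldNormedType.Exports.

#[global] Open Scope classical_set_scope.
#[global] Open Scope ring_scope.

Section Convexity.
Context {R : realType} {m : nat}.
Implicit Types (A : set 'rV[R]_m) (f : 'rV[R]_m -> R).

Definition strictly_convex_on A f : Prop :=
  convex_set A /\
  forall (x y : 'rV[R]_m) (s : R), A x -> A y -> x != y -> 0 < s < 1 ->
    f (s *: x + (1 - s) *: y) < s * f x + (1 - s) * f y.

Definition coercive_on A f : Prop :=
  forall c : R, 0 < c -> compact [set x | A x /\ f x <= c].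

End Convexity.

Section SmoothFunctions.
Context {R : realType}.
Implicit Types (U : R -> R -> R) (D : set (R * R)).

(* Functions of (t, x), in this order. *)
Definition dt U : R -> R -> R := fun t x => derive1 (U^~ x) t.
Definition dx U : R -> R -> R := fun t x => derive1 (U t) x.

Definition continuous_on D U : Prop :=
  forall p, D p -> {for p, continuous (fun q : R * R => U q.1 q.2)}.

(* Only meant for open sets D: [dt] and [dx] are two-sided derivatives. *)
Fixpoint Cn_on (n : nat) D U : Prop :=
  continuous_on D U /\
  if n is n'.+1 then
    [/\ forall p, D p -> derivable (U^~ p.2) p.1 1 /\ derivable (U p.1) p.2 1,
        Cn_on n' D (dt U) & Cn_on n' D (dx U)]
  else True.

Definition smooth_on D U : Prop := forall n, Cn_on n D U.

End SmoothFunctions.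

Section StefanDirichlet.
Context {R : realType}.

(* The integral is oriented, so that F is odd. *)
Definition F (z : \bar R) : R :=
  match z with
  | r%:E => (Num.sqrt pi)^-1 *
      (if 0 <= r
       then \int[lebesgue_measure]_(s in `[0, r]) expR (- (s ^+ 2 / 4))
       else - \int[lebesgue_measure]_(s in `[r, 0]) expR (- (s ^+ 2 / 4)))
  | +oo%E => 1
  | -oo%E => -1
  end.

(* A finite family y_1, ..., y_m is represented by y : nat -> R, whose other
   values are irrelevant; [ext m y] adds the conventions y_0 = +oo and
   y_(m+1) = 0. *)
Definition ext (m : nat) (y : nat -> R) (i : nat) : \bar R :=
  if i == 0%N then +oo%E else if (i <= m)%N then (y i)%:E else 0%E.

(* Row vectors are indexed from 0: [coord xi i] is the i-th coordinate,
   1 <= i <= m, counted from 1. *)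
Definition coord (m : nat) (xi : 'rV[R]_m) (i : nat) : R :=
  oapp (fun j : 'I_m => xi ord0 j) 0 (insub i.-1).

Definition xi_ (m : nat) (xi : 'rV[R]_m) : nat -> \bar R := ext m (coord xi).

Definition Omega (m : nat) : set 'rV[R]_m :=
  [set xi | forall i, (1 <= i <= m)%N -> (xi_ xi i.+1 < xi_ xi i)%E].

(* In the rest of the section the data are u_0, ..., u_(m+1) = u_D,
   a_0, ..., a_m, k_0, ..., k_m and d_1, ..., d_m. *)
Variables (m : nat) (u a k d : nat -> R).

Definition Fa (i : nat) (z : \bar R) : R := F (z * ((a i)^-1)%:E)%E.

Definition E (xi : 'rV[R]_m) : R :=
  - (\sum_(0 <= i < m.+1)
       k i * (u i.+1 - u i) * ln (Fa i (xi_ xi i) - Fa i (xi_ xi i.+1)))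
  + \sum_(1 <= i < m.+1) d i * coord xi i ^+ 2 / 4.

(* The region between the lines x = X_(i+1)(t) and x = X_i(t), occupied by
   phase i; temperature decreases with x, so the warmer side of the line
   x = X_i(t) is x < X_i(t). *)
Definition phase (X : nat -> R -> R) (i : nat) : set (R * R) :=
  [set p | 0 < p.1 /\
     (ext m (X^~ p.1) i.+1 < p.2%:E < ext m (X^~ p.1) i)%E].

(* U(t, x) solves the problem with phase transition lines x = X_i(t). *)
Record Stefan_Dirichlet (U : R -> R -> R) (X : nat -> R -> R) : Prop := {
  SD_ordered : forall (i : nat) (t : R), (i <= m)%N -> 0 < t ->
    (ext m (X^~ t) i.+1 < ext m (X^~ t) i)%E;
  SD_line : forall (i : nat) (t : R), (1 <= i <= m)%N -> 0 < t ->
    derivable (X i) t 1 /\ U t (X i t) = u i;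
  (* the second alternative occurs only for i = 0 and u_0 = u_1 *)
  SD_phase : forall i p, (i <= m)%N -> phase X i p ->
    u i < U p.1 p.2 < u i.+1 \/ u i = u i.+1 /\ U p.1 p.2 = u i;
  SD_continuous : continuous_on [set p | 0 < p.1 /\ 0 < p.2] U;
  SD_smooth : forall i, (i <= m)%N -> smooth_on (phase X i) U;
  SD_heat : forall (i : nat) (t x : R), (i <= m)%N -> 0 < t -> 0 < x ->
    u i < U t x < u i.+1 -> dt U t x = a i ^+ 2 * dx (dx U) t x;
  SD_stefan : forall (i : nat) (t : R), (1 <= i <= m)%N -> 0 < t ->
    exists ux_warm ux_cold : R,
      [/\ dx U t x @[x --> (X i t)^'-] --> ux_warm,
          dx U t x @[x --> (X i t)^'+] --> ux_cold &
          d i * derive1 (X i) t + k i * ux_warm - k i.-1 * ux_cold = 0];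
  SD_initial : forall x : R, 0 < x -> U t x @[t --> 0^'+] --> u 0%N;
  SD_boundary : forall t : R, 0 < t -> U t x @[x --> 0^'+] --> u m.+1
}.

Definition selfsimilar_form (xi : 'rV[R]_m) (v : R -> R) : Prop :=
  (forall i (z : R), (i <= m)%N -> (xi_ xi i.+1 < z%:E < xi_ xi i)%E ->
     v z = u i + (u i.+1 - u i) / (Fa i (xi_ xi i.+1) - Fa i (xi_ xi i))
                 * (Fa i z%:E - Fa i (xi_ xi i))) /\
  (forall i, (1 <= i <= m)%N -> v (coord xi i) = u i).

(* Only the values of v on the positive half-line matter. *)
Definition selfsimilar_solution (xi : 'rV[R]_m) (v : R -> R) : Prop :=
  [/\ Omega xi, selfsimilar_form xi v &
      Stefan_Dirichlet (fun t x => v (x / Num.sqrt t))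
                       (fun i t => coord xi i * Num.sqrt t)].

End StefanDirichlet.

(* Main.v *)
Require Import Defs.
From mathcomp Require Import ring lra.

(** Let D_i = F (xi_i / a_i) - F (xi_(i+1) / a_i) and
    c_i = k_i (u_(i+1) - u_i), so that
    E = - sum_i c_i ln D_i + sum_i d_i xi_i ^ 2 / 4. The proof rests on one
    inequality: on Omega, E lies strictly above its tangent planes
    ([E_gradient_lt]).

    This inequality is the sum over the phases of the tangent inequality for
    - ln (F x - F y) on x > y >= 0 ([ln_F_gradient_lt]), a strictly convex
    function: its Hessian determinant is positive because the function
    z |-> F' z / z + F z / 2, whose derivative is - F' z / z ^ 2, decreases
    ([F_hessian_det]). Phase 0, where xi_0 = +oo, is reached by letting x tend
    to +oo. For i >= 1, D_i depends on xi_i and c_i > 0; hence the inequality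
    is strict even if u_0 = u_1, when phase 0 has weight zero.

    The tangent inequality at the points between x and y gives strict
    convexity ([strictly_convex_E]). At a zero of the gradient it says that
    this point is the unique global minimum ([critical_lt]); applied between
    two points of a coordinate line, it shows that the gradient vanishes at a
    minimum ([min_critical]). A minimum exists by coercivity ([coercive_E]):
    every term of E is nonnegative, so a bound on E bounds D_i from below for
    i >= 1, which keeps successive lines apart; and xi_1 is bounded by the term
    of phase 0 if u_0 < u_1, and by d_1 xi_1 ^ 2 / 4 otherwise.

    A self-similar function of the prescribed form meets all the requirements
    of the problem except the Stefan conditions, because F'' z = - z / 2 * F' z
    turns the heat equation into an identity. The Stefan condition on line i is
    the i-th component of the equation grad E = 0 divided by sqrt t
    ([stefan_flux_gradE]). Solutions therefore correspond to the critical
    points of E, and there is exactly one. *)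

Set Implicit Arguments.
Unset Strict Implicit.
Unset Printing Implicit Defensive.

#[local] Arguments F : simpl never.

(** * The error function F *)

Section ErrorFunction.
Context {R : realType}.
Implicit Types x y z : R.

Definition F' x : R := (Num.sqrt pi)^-1 * expR (- (x ^+ 2 / 4)).

Lemma F'_gt0 x : 0 < F' x.
Proof. by rewrite mulr_gt0 ?expR_gt0// invr_gt0 sqrtr_gt0 pi_gt0. Qed.

Lemma is_derive_expR_sqr x :
  is_derive x 1 (fun y : R => expR (- (y ^+ 2 / 4))) (- (x / 2) * expR (- (x ^+ 2 / 4))).
Proof.
have h : is_derive x 1 (fun y : R => - (y ^+ 2 / 4)) (- (x / 2)).
  by apply: is_derive_eq; rewrite /GRing.scale/=; field.
apply: (is_derive_eq (is_derive1_comp _ h)).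
by rewrite mulrC.
Qed.

Lemma is_derive_F' x : is_derive x 1 F' (- (x / 2) * F' x).
Proof.
have := is_deriveZ (Num.sqrt pi)^-1 (is_derive_expR_sqr x).
by move=> h; apply: (is_derive_eq h); rewrite /GRing.scale/= /F'; ring.
Qed.

Lemma is_derive_continuous (f : R -> R) x df :
  is_derive x 1 f df -> {for x, continuous f}.
Proof. by move=> [+ _] => /derivable1_diffP/differentiable_continuous. Qed.

Lemma MVT_is_derive (f df : R -> R) x y : x < y ->
  (forall z, x <= z <= y -> is_derive z 1 f (df z)) ->
  exists2 c, x < c < y & f y - f x = df c * (y - x).
Proof.
move=> xy fdf; have [||c cxy h] := @MVT R f df x y xy.
- by move=> z; rewrite in_itv/= => /andP[? ?]; apply: fdf; rewrite !ltW.
- apply: derivable_within_continuous => z; rewrite in_itv/= => /fdf.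
  by case.
by exists c => //; rewrite in_itv in cxy.
Qed.

Lemma continuous_F' : continuous F'.
Proof. by move=> x; exact: is_derive_continuous (is_derive_F' x). Qed.

Lemma F'_le x : F' x <= (Num.sqrt pi)^-1.
Proof.
rewrite /F' ler_piMr ?invr_ge0 ?sqrtr_ge0//.
by rewrite -expR0 ler_expR oppr_le0 divr_ge0 ?sqr_ge0.
Qed.

Let f (s : R) : R := expR (- (s ^+ 2 / 4)).

Let cf : continuous f.
Proof. by move=> x; exact: is_derive_continuous (is_derive_expR_sqr x). Qed.

Let intf (a b : R) : lebesgue_measure.-integrable `[a, b] (EFin \o f).
Proof.
apply: continuous_compact_integrable; first exact: segment_compact.
exact: continuous_subspaceT.
Qed.

(** F is defined by cases on the sign of its argument. Integrating from a base
    point below both 0 and x makes F, near x, the difference of two values of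
    one primitive; this also covers x = 0. *)
Lemma is_derive_F x : is_derive x 1 (fun y => F y%:E) (F' x).
Proof.
pose a := Num.min x 0 - 1.
have ax : a < x by rewrite /a ltrBlDr gt_min ltrDl ltr01.
have a0 : a < 0 by rewrite /a ltrBlDr gt_min ltrDl ltr01 orbT.
pose G (y : R) := \int[lebesgue_measure]_(s in `[a, y]) f s.
have dG : is_derive x 1 G (f x).
  have [|d1 d2] := @continuous_FTC1_closed R f a x (x + 1) _ (intf _ _) ax (@cf x).
    by rewrite ltrDl.
  by apply: (DeriveDef d1); rewrite -derive1E; exact: d2.
have dH : is_derive x 1 (fun y => (Num.sqrt pi)^-1 * (G y - G 0)) (F' x).
  have h1 : is_derive x 1 (fun y => G y - G 0) (f x).
    by apply: is_derive_eq; rewrite subr0.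
  exact: (is_deriveZ (Num.sqrt pi)^-1 h1).
apply: near_eq_is_derive dH.
near=> y.
have ay : a < y by near: y; exact: lt_nbhsr.
rewrite /F; congr (_ * _); rewrite /G.
case: (leP 0 y) => y0.
  rewrite (@Rintegral_itvB R f (BLeft a) (BRight y) 0) ?bnd_simp// ?ltW//.
  rewrite Rintegral_itv_obnd_cbnd//.
  by apply: integrableS (intf 0 y) => //; apply: subset_itv_oc_cc.
apply: oppr_inj; rewrite opprB opprK.
rewrite (@Rintegral_itvB R f (BLeft a) (BRight 0) y) ?bnd_simp// ?ltW//.
rewrite Rintegral_itv_obnd_cbnd//.
by apply: integrableS (intf y 0) => //; apply: subset_itv_oc_cc.
Unshelve. all: by end_near. Qed.

Lemma continuous_F : continuous (fun y : R => F y%:E).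
Proof. by move=> x; exact: is_derive_continuous (is_derive_F x). Qed.

Lemma F0 : F (0 : \bar R) = 0.
Proof. by rewrite -[0%E]/((0 : R)%:E) /F lexx set_itv1 Rintegral_set1 mulr0. Qed.

Lemma F_MVT x y : x < y ->
  exists2 c, x < c < y & F y%:E - F x%:E = F' c * (y - x).
Proof.
move=> xy.
exact: (@MVT_is_derive (fun w => F w%:E) F' _ _ xy (fun z _ => is_derive_F z)).
Qed.

Lemma F_lt x y : x < y -> F x%:E < F y%:E.
Proof.
move=> xy; have [c _ h] := F_MVT xy.
by rewrite -subr_gt0 h mulr_gt0 ?F'_gt0// subr_gt0.
Qed.

Lemma F_le x y : x <= y -> F x%:E <= F y%:E.
Proof. by rewrite le_eqVlt => /predU1P[->//|/F_lt/ltW]. Qed.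

(** The change of variable s = 2 t: the right-hand side is a primitive of
    exp (- t ^ 2) that vanishes at 0. *)
Lemma integral0_gaussE (r : R) : 0 < r ->
  gauss_integral_proof.integral0_gauss r = Num.sqrt pi / 2 * F (r *+ 2)%:E.
Proof.
move=> r0; pose G (t : R) := Num.sqrt pi / 2 * F (t *+ 2)%:E.
have dG (t : R) : is_derive t 1 G (gauss_fun t).
  have h2 : is_derive t 1 (fun t : R => t *+ 2) 2.
    by apply: is_derive_eq; rewrite mulr2n.
  have := is_deriveZ (Num.sqrt pi / 2) (is_derive1_comp (is_derive_F _) h2).
  move=> h; apply: (is_derive_eq h).
  rewrite /F' /gauss_fun /GRing.scale/= (_ : (t *+ 2) ^+ 2 / 4 = t ^+ 2); last first.
    by rewrite -mulr_natr; field.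
  have /lt0r_neq0 : 0 < Num.sqrt (@pi R) by rewrite sqrtr_gt0 pi_gt0.
  by move=> pi0; field.
rewrite /gauss_integral_proof.integral0_gauss /Rintegral.
rewrite (@continuous_FTC2 R gauss_fun G)//=.
- by rewrite /G mul0rn F0 mulr0 oppr0 addr0.
- by apply: continuous_subspaceT; exact: continuous_gauss_fun.
- split.
  + by move=> t _; case: (dG t).
  + by apply: cvg_at_right_filter; exact: (is_derive_continuous (dG 0)).
  + by apply: cvg_at_left_filter; exact: (is_derive_continuous (dG r)).
- by move=> t _; rewrite derive1E; case: (dG t).
Qed.

(** The known value of the Gaussian integral is that of its square; as F is
    nonnegative on the positive half-line, a square root recovers F itself. *)
Lemma F_cvg1 : F z%:E @[z --> +oo] --> (1 : R).
Proof.
have pi0 : Num.sqrt (@pi R) != 0 by rewrite gt_eqF// sqrtr_gt0 pi_gt0.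
have h0 : (Num.sqrt pi / 2 * F (r *+ 2)%:E) ^+ 2 @[r --> +oo] --> (pi / 4 : R).
  apply: cvg_trans (@gauss_integral_proof.cvg_integral0_gauss_sqr R).
  by apply: near_eq_cvg; near=> r; rewrite integral0_gaussE.
have h1 : F (r *+ 2)%:E @[r --> +oo] --> (1 : R).
  have h : Num.sqrt ((F (r *+ 2)%:E) ^+ 2) @[r --> +oo] --> Num.sqrt (1 : R).
    apply: continuous_cvg => //; first exact: sqrt_continuous.
    rewrite [X in _ --> X](_ : _ = (Num.sqrt pi / 2) ^- 2 * (pi / 4)); last first.
      rewrite exprMn sqr_sqrtr ?pi_ge0// exprVn -[2 ^+ 2]natrX.
      have p0 : @pi R != 0 by rewrite gt_eqF// pi_gt0.
      by rewrite natrX; move: (@pi R) p0 => p p0; field.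
    have h3 : (Num.sqrt pi / 2) ^- 2 * (Num.sqrt pi / 2 * F (r *+ 2)%:E) ^+ 2 @[r --> +oo]
        --> (Num.sqrt pi / 2) ^- 2 * (pi / 4 : R) by exact: cvgM (cvg_cst _) h0.
    apply: cvg_trans h3.
    apply: near_eq_cvg; near=> r; rewrite (exprMn 2 _ (F _)) mulKf// sqrf_eq0.
    by rewrite mulf_neq0// invr_eq0.
  rewrite sqrtr1 in h; apply: cvg_trans h.
  apply: near_eq_cvg; near=> r; rewrite sqrtr_sqr ger0_norm//.
  by rewrite -F0 F_le// mulrn_wge0.
have h2 : (r / 2 : R) @[r --> +oo] --> +oo.
  by apply: gt0_cvgMly; [rewrite invr_gt0|exact: cvg_id].
have h3 : F ((r / 2 : R) *+ 2)%:E @[r --> +oo] --> (1 : R) := cvg_comp _ _ h2 h1.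
apply: cvg_trans h3; apply: near_eq_cvg; near=> r.
by congr (F _%:E); field.
Unshelve. all: by end_near. Qed.

Lemma F_lt1 x : F x%:E < 1.
Proof.
apply: lt_le_trans (F_lt (_ : x < x + 1)) _; first by rewrite ltrDl.
rewrite leNgt; apply/negP => h.
near (pinfty_nbhs R) => y.
have xy : x + 1 < y by near: y; apply: nbhs_pinfty_gt; rewrite num_real.
have : F y%:E < F (x + 1)%:E by near: y; exact: (cvgr_lt 1 F_cvg1).
by move=> /lt_trans/(_ (F_lt xy)); rewrite ltxx.
Unshelve. all: by end_near. Qed.

End ErrorFunction.

(** * Strict log-concavity of the increments of F *)

Section LogConcavity.
Context {R : realType}.
Implicit Types x y z : R.

(** With D = F x - F y, the Hessian determinant of - ln (F x - F y) is
    F' x * F' y / (2 D ^ 3) times the difference of the two sides. For y > 0,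
    dividing by x y turns the inequality into h x < h y, where h z =
    F' z / z + F z / 2 has the derivative - F' z / z ^ 2. *)
Lemma F_hessian_det x y : 0 <= y -> y < x ->
  y * F' x + x * y * (F x%:E - F y%:E) / 2 < x * F' y.
Proof.
rewrite le_eqVlt => /predU1P[<- x0|y0 yx].
  by rewrite mulr0 !mul0r addr0 mulr_gt0 ?F'_gt0.
have x0 : 0 < x by exact: lt_trans yx.
pose h z := F' z / z + F z%:E / 2.
have [z /andP[yz zx]|c cyx] := @MVT_is_derive R h (fun z => - (F' z / z ^+ 2)) _ _ yx.
  have z0 : z != 0 by rewrite gt_eqF// (lt_le_trans y0).
  have d1 := is_deriveM (is_derive_F' z) (is_deriveV z0 (is_derive_id z 1)).
  have d2 := is_deriveZ 2^-1 (is_derive_F z).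
  have := is_deriveD d1 d2.
  rewrite (_ : _ + _ = h); last first.
    by apply/funext => t; rewrite /h /= [_ / 2]mulrC.
  move=> d; apply: (is_derive_eq d); rewrite /GRing.scale/=; field.
  by [].
rewrite /h => /eqP; rewrite subr_eq => /eqP.
have : - (F' c / c ^+ 2) * (x - y) < 0.
  case/andP: cyx => yc _.
  rewrite pmulr_llt0 ?subr_gt0// oppr_lt0 divr_gt0 ?F'_gt0// exprn_gt0//.
  exact: lt_trans yc.
set d := _ * (x - y) => d0 e.
have {d0}e : F' x / x + F x%:E / 2 < F' y / y + F y%:E / 2 by lra.
have xy0 : 0 < x * y by rewrite mulr_gt0.
rewrite -(ltr_pM2l xy0) in e.
have e1 : x * y * (F' x / x + F x%:E / 2) = y * F' x + x * y * F x%:E / 2.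
  by field; rewrite gt_eqF.
have e2 : x * y * (F' y / y + F y%:E / 2) = x * F' y + x * y * F y%:E / 2.
  by field; rewrite gt_eqF.
by rewrite e1 e2 in e; lra.
Qed.

(** Let g be the restriction of F x - F y to the line through (x, y) with
    direction (a, b). The inequality is g * g'' < g' ^ 2, that is,
    (ln g)'' < 0. The difference of its sides is a quadratic form in (a, b),
    positive because its determinant and its leading coefficient are. *)
Lemma F_hessian_pos x y (a b : R) : 0 <= y -> y < x -> (a != 0) || (b != 0) ->
  (F x%:E - F y%:E) * (- (x / 2) * F' x * a ^+ 2 + y / 2 * F' y * b ^+ 2)
  < (F' x * a - F' y * b) ^+ 2.
Proof.
move=> y0 yx ab; have := F_hessian_det y0 yx.
have : 0 < F x%:E - F y%:E by rewrite subr_gt0 F_lt.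
have := F'_gt0 x; have := F'_gt0 y.
move: (F x%:E - F y%:E) (F' x) (F' y) => D p q q0 p0 D0 det.
have x0 : 0 < x by exact: le_lt_trans yx.
have A0 : 0 < p ^+ 2 + x / 2 * p * D.
  by rewrite addr_gt0 ?exprn_gt0// !mulr_gt0// divr_gt0.
(* A is the coefficient of a ^ 2, and K the determinant of the form. *)
pose A := p ^+ 2 + x / 2 * p * D.
pose K := p * q * D / 2 * (x * q - (y * p + x * y * D / 2)).
have K0 : 0 < K by rewrite !mulr_gt0// subr_gt0.
rewrite -subr_gt0 -(pmulr_rgt0 _ A0).
rewrite [X in 0 < X](_ : _ = (A * a - p * q * b) ^+ 2 + K * b ^+ 2); last first.
  by rewrite /A /K; field.
case: (eqVneq b 0) ab => [-> | b0 _].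
  rewrite orbF => a0.
  by rewrite mulr0 subr0 expr0n mulr0 addr0 exprn_even_gt0//= mulf_neq0// gt_eqF.
by rewrite ltr_wpDl ?sqr_ge0// mulr_gt0// exprn_even_gt0.
Qed.

(** On the segment from (x, y) to (x', y'), let g be the value of F x - F y.
    Then L = g' / g decreases, so ln (g 1) - ln (g 0) = L c < L 0 for some c
    strictly between 0 and 1. *)
Lemma ln_F_gradient_lt x y x' y' : 0 <= y -> y < x -> 0 <= y' -> y' < x' ->
  (x' != x) || (y' != y) ->
  ln (F x'%:E - F y'%:E) <
  ln (F x%:E - F y%:E) + (F' x * (x' - x) - F' y * (y' - y)) / (F x%:E - F y%:E).
Proof.
move=> y0 yx y'0 yx' neq.
pose a := x' - x; pose b := y' - y.
pose X (s : R) := x + s * a; pose Y (s : R) := y + s * b.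
pose g s := F (X s)%:E - F (Y s)%:E.
pose g1 s := F' (X s) * a - F' (Y s) * b.
pose g2 s := - (X s / 2) * F' (X s) * a ^+ 2 + Y s / 2 * F' (Y s) * b ^+ 2.
have XY (s : R) : 0 <= s <= 1 -> 0 <= Y s < X s.
  case/andP=> s0 s1; apply/andP; split.
    rewrite (_ : Y s = (1 - s) * y + s * y'); last by rewrite /Y /b; ring.
    by rewrite addr_ge0 ?mulr_ge0 ?subr_ge0.
  rewrite -subr_gt0 (_ : _ - _ = (1 - s) * (x - y) + s * (x' - y')); last first.
    by rewrite /X /Y /a /b; ring.
  have [->|sn0] := eqVneq s 0; first by rewrite subr0 mul1r mul0r addr0 subr_gt0.
  rewrite ltr_wpDl//; first by rewrite mulr_ge0 ?subr_ge0// ltW.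
  by rewrite mulr_gt0 ?subr_gt0// lt0r sn0.
have g0 (s : R) : 0 <= s <= 1 -> 0 < g s.
  by move=> /XY/andP[_ ?]; rewrite subr_gt0 F_lt.
have dX (s : R) : is_derive s 1 X a.
  by apply: is_derive_eq; rewrite /GRing.scale/=; ring.
have dY (s : R) : is_derive s 1 Y b.
  by apply: is_derive_eq; rewrite /GRing.scale/=; ring.
have dg (s : R) : is_derive s 1 g (g1 s).
  exact: is_deriveB (is_derive1_comp (is_derive_F _) (dX s))
                    (is_derive1_comp (is_derive_F _) (dY s)).
have dg1 (s : R) : is_derive s 1 g1 (g2 s).
  have d1 := is_deriveZ a (is_derive1_comp (is_derive_F' _) (dX s)).
  have d2 := is_deriveZ b (is_derive1_comp (is_derive_F' _) (dY s)).
  have := is_deriveB d1 d2.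
  rewrite (_ : _ - _ = g1); last first.
    by apply/funext => t; rewrite /g1 /= mulrC [F' _ * b]mulrC.
  by move=> d; apply: (is_derive_eq d); rewrite /GRing.scale/= /g2; ring.
pose L s := g1 s / g s.
have dL (s : R) : 0 <= s <= 1 -> is_derive s 1 L ((g2 s * g s - g1 s ^+ 2) / g s ^+ 2).
  move=> /g0 gs; have gs0 : g s != 0 by rewrite gt_eqF.
  have d := is_deriveM (dg1 s) (is_deriveV gs0 (dg s)).
  by apply: (is_derive_eq d); rewrite /GRing.scale/=; field.
have dln (s : R) : 0 <= s <= 1 -> is_derive s 1 (@ln R \o g) (L s).
  move=> /g0 gs; apply: (is_derive_eq (is_derive1_comp (is_derive1_ln gs) (dg s))).
  by rewrite mulrC.
have [c /andP[c0 c1]] := MVT_is_derive ltr01 dln.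
have [s /andP[s0 sc]|c' /andP[c'0 c'c]] :=
    @MVT_is_derive R L (fun s => (g2 s * g s - g1 s ^+ 2) / g s ^+ 2) 0 c c0.
  by apply: dL; rewrite s0 (le_trans sc)// ltW.
have c'01 : 0 <= c' <= 1 by rewrite !ltW// (lt_trans c'c).
have neg : (g2 c' * g c' - g1 c' ^+ 2) / g c' ^+ 2 < 0.
  rewrite pmulr_llt0 ?invr_gt0 ?exprn_gt0 ?g0// subr_lt0 mulrC.
  have /andP[? ?] := XY _ c'01.
  by apply: F_hessian_pos => //; rewrite !subr_eq0.
move=> h2 h1.
have X0 : X 0 = x by rewrite /X mul0r addr0.
have Y0 : Y 0 = y by rewrite /Y mul0r addr0.
have X1 : X 1 = x' by rewrite /X /a mul1r addrC subrK.
have Y1 : Y 1 = y' by rewrite /Y /b mul1r addrC subrK.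
have L0 : L 0 = (F' x * (x' - x) - F' y * (y' - y)) / (F x%:E - F y%:E).
  by rewrite /L /g1 /g X0 Y0.
have gE0 : g 0 = F x%:E - F y%:E by rewrite /g X0 Y0.
have gE1 : g 1 = F x'%:E - F y'%:E by rewrite /g X1 Y1.
rewrite -L0 -gE0 -gE1.
have h3 : ln (g 1) = ln (g 0) + L c.
  by move: h1; rewrite /= subr0 mulr1 => <-; rewrite addrC subrK.
by rewrite h3 ltrD2l -subr_lt0 h2 subr0 pmulr_llt0.
Qed.

Lemma ln_F_gradient_le x y x' y' : 0 <= y -> y < x -> 0 <= y' -> y' < x' ->
  ln (F x'%:E - F y'%:E) <=
  ln (F x%:E - F y%:E) + (F' x * (x' - x) - F' y * (y' - y)) / (F x%:E - F y%:E).
Proof.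
move=> y0 yx y'0 yx'; have [neq|] := boolP ((x' != x) || (y' != y)).
  exact/ltW/ln_F_gradient_lt.
rewrite negb_or !negbK => /andP[/eqP -> /eqP ->].
by rewrite subrr [y - y]subrr !mulr0 subrr mul0r addr0.
Qed.

(** The previous inequality with x = x' tending to +oo, where F tends to 1. *)
Lemma ln_F_gradient_oo y y' : 0 <= y -> 0 <= y' ->
  ln (1 - F y'%:E) <= ln (1 - F y%:E) - F' y * (y' - y) / (1 - F y%:E).
Proof.
move=> y0 y'0.
have pos t : 0 < 1 - F t%:E :> R by rewrite subr_gt0 F_lt1.
have cln t : ln (F z%:E - F t%:E) @[z --> +oo] --> ln (1 - F t%:E : R).
  apply: continuous_cvg; first exact: continuous_ln.
  by apply: cvgB; [exact: F_cvg1|exact: cvg_cst].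
have cr : ln (F z%:E - F y%:E) - F' y * (y' - y) / (F z%:E - F y%:E)
    @[z --> +oo] --> ln (1 - F y%:E) - F' y * (y' - y) / (1 - F y%:E : R).
  apply: cvgB; first exact: cln.
  apply: cvgM; first exact: cvg_cst.
  apply: cvgV; first by rewrite gt_eqF.
  by apply: cvgB; [exact: F_cvg1|exact: cvg_cst].
apply: (ler_cvg_to (cln y') cr); near=> z.
have := @ln_F_gradient_le z y z y' y0 _ y'0 _.
rewrite subrr mulr0 sub0r mulNr; apply.
- by near: z; apply: nbhs_pinfty_gt; rewrite num_real.
- by near: z; apply: nbhs_pinfty_gt; rewrite num_real.
Unshelve. all: by end_near. Qed.

End LogConcavity.

(** * Coordinates on Omega *)

Section Coordinates.
Context {R : realType} {m : nat}.
Implicit Types (x y : 'rV[R]_m) (i : nat).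

Lemma coordD x y i : coord (x + y) i = coord x i + coord y i.
Proof. by rewrite /coord; case: insub => [j|] /=; rewrite ?mxE ?addr0. Qed.

Lemma coordZ (s : R) x i : coord (s *: x) i = s * coord x i.
Proof. by rewrite /coord; case: insub => [j|] /=; rewrite ?mxE ?mulr0. Qed.

Lemma coord_ord x (j : 'I_m) : coord x j.+1 = x ord0 j.
Proof. by rewrite /coord /= valK. Qed.

(** Out of range, [coord] returns its default value 0, which coincides with the
    convention xi_(m+1) = 0: the index m + 1 can be treated like the others. *)
Lemma coord_last x : coord x m.+1 = 0.
Proof. by rewrite /coord /= insubF ?ltnn. Qed.

Lemma coord_nat x i (im : (i < m)%N) : coord x i.+1 = x ord0 (Ordinal im).
Proof. by rewrite -coord_ord. Qed.

Lemma xi_0 x : xi_ x 0 = +oo%E.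
Proof. by []. Qed.

Lemma xi_E x i : (1 <= i <= m.+1)%N -> xi_ x i = (coord x i)%:E.
Proof.
case/andP; case: i => // i _ im; rewrite /xi_ /ext /=.
case: ltnP => // mi; have -> : i = m by apply/eqP; rewrite eqn_leq mi andbT -ltnS.
by rewrite coord_last.
Qed.

Lemma OmegaP x :
  Omega x <-> forall i, (1 <= i <= m)%N -> coord x i.+1 < coord x i.
Proof.
split=> h i /[dup] im /h; rewrite !xi_E ?lte_fin//; case/andP: im => i1 im;
  by rewrite ?i1 ?(leqW im) ?ltnS.
Qed.

Lemma Omega_ge0 x i : Omega x -> (1 <= i <= m.+1)%N -> 0 <= coord x i.
Proof.
move=> /OmegaP xO /andP[i1 im].
have : (i + (m.+1 - i) = m.+1)%N by rewrite subnKC.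
move: (m.+1 - i)%N => n; elim: n i i1 {im} => [|n IH] i i1.
  by rewrite addn0 => ->; rewrite coord_last.
rewrite addnS -addSn => in_m; apply: (le_trans (IH i.+1 _ in_m)) => //.
apply/ltW/xO; rewrite i1 -ltnS -in_m; exact: leq_addr.
Qed.

Lemma Omega_gt0 x i : Omega x -> (1 <= i <= m)%N -> 0 < coord x i.
Proof.
move=> xO /[dup] im /((OmegaP x).1 xO); apply: le_lt_trans; apply: Omega_ge0 => //.
by case/andP: im => _; rewrite ltnS.
Qed.

Lemma continuous_coord i : continuous (fun x : 'rV[R]_m => coord x i).
Proof.
rewrite /coord; case: insub => [j|] /=; last exact: cst_continuous.
exact: coord_continuous.
Qed.

Lemma convex_Omega : convex_set (@Omega R m).
Proof.
apply/convex_setW => x y; rewrite !inE => /OmegaP xO /OmegaP yO s s0 s1.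
rewrite inE; apply/OmegaP => i im.
rewrite !coordD !coordZ ltrD// ltr_pM2l ?xO ?yO//.
by rewrite subr_gt0.
Qed.

End Coordinates.

(** * Smooth functions of (t, x) on an open set *)

Section SmoothCalculus.
Context {R : realType} (D : set (R * R)).
Hypothesis openD : open D.
Implicit Types (U V : R -> R -> R) (p : R * R).

Lemma near_slice_t p : D p -> \forall t \near p.1, D (t, p.2).
Proof.
move=> Dp; have [[A B] [/= nA nB] AB] : nbhs p D by exact: open_nbhs_nbhs.
by apply: filterS nA => t At; apply: AB; split=> //=; exact: nbhs_singleton nB.
Qed.

Lemma near_slice_x p : D p -> \forall x \near p.2, D (p.1, x).
Proof.
move=> Dp; have [[A B] [/= nA nB] AB] : nbhs p D by exact: open_nbhs_nbhs.
by apply: filterS nB => x Bx; apply: AB; split=> //=; exact: nbhs_singleton nA.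
Qed.

Lemma continuous_on_eq U V : (forall p, D p -> U p.1 p.2 = V p.1 p.2) ->
  continuous_on D U -> continuous_on D V.
Proof.
move=> UV cU p Dp; rewrite /prop_for /continuous_at -(UV _ Dp).
apply: cvg_trans (cU p Dp); apply: near_eq_cvg.
have : nbhs p D by exact: open_nbhs_nbhs.
by apply: filterS => q /UV.
Qed.

(** On an open set D, the two-sided partial derivatives at a point of D depend
    only on the values in D. *)
Lemma Cn_on_eq n U V : (forall p, D p -> U p.1 p.2 = V p.1 p.2) ->
  Cn_on n D U -> Cn_on n D V.
Proof.
elim: n U V => [|n IH] U V UV /= [cU]; first by split=> //; exact: continuous_on_eq cU.
have tUV p : D p -> \forall t \near p.1, U t p.2 = V t p.2.
  by move=> /near_slice_t; apply: filterS => t /UV.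
have xUV p : D p -> \forall x \near p.2, U p.1 x = V p.1 x.
  by move=> /near_slice_x; apply: filterS => x /UV.
case=> dU tU xU; split; first exact: continuous_on_eq cU.
split=> [p Dp||].
- have [h1 h2] := dU p Dp; split.
    exact: near_eq_derivable (tUV p Dp) h1.
  exact: near_eq_derivable (xUV p Dp) h2.
- apply: IH tU => p Dp; rewrite /dt !derive1E; exact: near_eq_derive (tUV p Dp).
- apply: IH xU => p Dp; rewrite /dx !derive1E; exact: near_eq_derive (xUV p Dp).
Qed.

Lemma Cn_on_continuous n U : Cn_on n D U -> continuous_on D U.
Proof. by case: n => [|n] []. Qed.

Lemma Cn_onW n U : Cn_on n.+1 D U -> Cn_on n D U.
Proof.
elim: n U => [|n IH] U [cU]; first by [].
case=> dU tU xU; split; first exact: cU.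
by split; [exact: dU|exact: (IH _ tU)|exact: (IH _ xU)].
Qed.

Lemma Cn_on_dt n U p : Cn_on n.+1 D U -> D p ->
  is_derive p.1 1 (U^~ p.2) (dt U p.1 p.2).
Proof. by case=> _ [dU _ _] /dU[h _]; apply: (DeriveDef h); rewrite /dt derive1E. Qed.

Lemma Cn_on_dx n U p : Cn_on n.+1 D U -> D p ->
  is_derive p.2 1 (U p.1) (dx U p.1 p.2).
Proof. by case=> _ [dU _ _] /dU[_ h]; apply: (DeriveDef h); rewrite /dx derive1E. Qed.

(** [dt U] and [dx U] may be anything outside D; hence Ut and Ux need to agree
    with them on D only. *)
Lemma Cn_onS n U Ut Ux : continuous_on D U ->
  (forall p, D p -> is_derive p.1 1 (U^~ p.2) (Ut p.1 p.2)) ->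
  (forall p, D p -> is_derive p.2 1 (U p.1) (Ux p.1 p.2)) ->
  Cn_on n D Ut -> Cn_on n D Ux -> Cn_on n.+1 D U.
Proof.
move=> cU dtU dxU nt nx; split; first exact: cU.
split.
- by move=> p Dp; split; [case: (dtU p Dp)|case: (dxU p Dp)].
- by apply: Cn_on_eq nt => p /dtU[_ <-]; rewrite /dt derive1E.
- by apply: Cn_on_eq nx => p /dxU[_ <-]; rewrite /dx derive1E.
Qed.

Lemma Cn_on_cst n (c : R) : Cn_on n D (fun _ _ => c).
Proof.
have cc e : continuous_on D (fun _ _ : R => e : R) by move=> p _; exact: cst_continuous.
elim: n c => [|n IH] c; first by split.
by apply: Cn_onS (IH 0) (IH 0) => // p _; exact: is_derive_cst.
Qed.

Lemma Cn_on_add n U V : Cn_on n D U -> Cn_on n D V ->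
  Cn_on n D (fun t x => U t x + V t x).
Proof.
elim: n U V => [|n IH] U V nU nV.
  by split=> // p Dp; apply: continuousD; [exact: nU.1|exact: nV.1].
have [cU [_ tU xU]] := nU; have [cV [_ tV xV]] := nV.
apply: Cn_onS (IH _ _ tU tV) (IH _ _ xU xV) => p Dp.
- by apply: continuousD; [exact: cU|exact: cV].
- exact: is_deriveD (Cn_on_dt nU Dp) (Cn_on_dt nV Dp).
- exact: is_deriveD (Cn_on_dx nU Dp) (Cn_on_dx nV Dp).
Qed.

Lemma Cn_on_mul n U V : Cn_on n D U -> Cn_on n D V ->
  Cn_on n D (fun t x => U t x * V t x).
Proof.
elim: n U V => [|n IH] U V nU nV.
  by split=> // p Dp; apply: continuousM; [exact: nU.1|exact: nV.1].
have [cU [_ tU xU]] := nU; have [cV [_ tV xV]] := nV.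
have [U' V'] := (Cn_onW nU, Cn_onW nV).
have nt := Cn_on_add (IH _ _ U' tV) (IH _ _ V' tU).
have nx := Cn_on_add (IH _ _ U' xV) (IH _ _ V' xU).
apply: Cn_onS nt nx => p Dp.
- by apply: continuousM; [exact: cU|exact: cV].
- exact: is_deriveM (Cn_on_dt nU Dp) (Cn_on_dt nV Dp).
- exact: is_deriveM (Cn_on_dx nU Dp) (Cn_on_dx nV Dp).
Qed.

Lemma Cn_on_expR n U : Cn_on n D U -> Cn_on n D (fun t x => expR (U t x)).
Proof.
elim: n U => [|n IH] U nU.
  split=> // p Dp; apply: (@continuous_comp _ _ _ (fun q : R * R => U q.1 q.2)).
    exact: nU.1.
  exact: continuous_expR.
have [cU [_ tU xU]] := nU; have eU := IH _ (Cn_onW nU).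
apply: Cn_onS (Cn_on_mul eU tU) (Cn_on_mul eU xU) => p Dp.
- apply: (@continuous_comp _ _ _ (fun q : R * R => U q.1 q.2)); first exact: cU.
  exact: continuous_expR.
- exact: is_derive1_comp (is_derive_expR _) (Cn_on_dt nU Dp).
- exact: is_derive1_comp (is_derive_expR _) (Cn_on_dx nU Dp).
Qed.

(** F' is a constant times an exponential, which reduces the partial
    derivatives of F (U t x) to products and exponentials. *)
Lemma Cn_on_F n U : Cn_on n D U -> Cn_on n D (fun t x => F (U t x)%:E).
Proof.
move=> nU; have cF p : D p -> {for p, continuous (fun q => F (U q.1 q.2)%:E)}.
  move=> Dp; apply: (@continuous_comp _ _ _ (fun q : R * R => U q.1 q.2) (fun z => F z%:E)).
    exact: Cn_on_continuous nU p Dp.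
  exact: continuous_F.
case: n nU => [|n] nU; first by split.
have [cU [_ tU xU]] := nU; have nU' := Cn_onW nU.
have pU : Cn_on n D (fun t x => F' (U t x)).
  apply: Cn_on_mul; first exact: Cn_on_cst.
  apply: Cn_on_expR; apply: (@Cn_on_eq _ (fun t x => - 4^-1 * (U t x * U t x))).
    by move=> p _; rewrite expr2 mulNr mulrC.
  by apply: Cn_on_mul; [exact: Cn_on_cst|exact: Cn_on_mul].
apply: Cn_onS (Cn_on_mul pU tU) (Cn_on_mul pU xU) => p Dp; first exact: cF.
- exact: is_derive1_comp (is_derive_F _) (Cn_on_dt nU Dp).
- exact: is_derive1_comp (is_derive_F _) (Cn_on_dx nU Dp).
Qed.

Hypothesis D_gt0 : forall p, D p -> 0 < p.1.

Lemma is_derive_invsqrt (t : R) : 0 < t ->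
  is_derive t 1 (fun t => (Num.sqrt t)^-1) (- 2^-1 * (Num.sqrt t)^-1 ^+ 3).
Proof.
move=> t0; have s0 : Num.sqrt t != 0 by rewrite gt_eqF// sqrtr_gt0.
apply: (is_derive_eq (is_deriveV s0 (is_derive1_sqrt t0))).
by rewrite /GRing.scale/=; field.
Qed.

Lemma Cn_on_invsqrt n : Cn_on n D (fun t _ => (Num.sqrt t)^-1).
Proof.
have cS : continuous_on D (fun t _ : R => (Num.sqrt t)^-1).
  move=> p Dp; apply: (@continuous_comp _ _ _ fst (fun t : R => (Num.sqrt t)^-1)).
    exact: cvg_fst.
  exact: is_derive_continuous (is_derive_invsqrt (D_gt0 Dp)).
elim: n => [|n IH]; first by split.
have n3 : Cn_on n D (fun t _ => - 2^-1 * (Num.sqrt t)^-1 ^+ 3).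
  apply: Cn_on_mul; first exact: Cn_on_cst.
  by apply: Cn_on_mul => //; exact: Cn_on_mul.
apply: Cn_onS n3 (Cn_on_cst n 0) => // p Dp.
exact: is_derive_invsqrt (D_gt0 Dp).
Qed.

Lemma Cn_on_x n : Cn_on n D (fun _ x => x).
Proof.
have cx : continuous_on D (fun _ x : R => x) by move=> p _; exact: cvg_snd.
case: n => [|n]; first by split.
apply: Cn_onS (Cn_on_cst n 0) (Cn_on_cst n 1) => // p Dp.
exact: is_derive_cst.
Qed.

Lemma smooth_on_profile (A B a : R) :
  smooth_on D (fun t x => A + B * F (x / Num.sqrt t / a)%:E).
Proof.
move=> n; apply: Cn_on_add; first exact: Cn_on_cst.
apply: Cn_on_mul; first exact: Cn_on_cst.
apply: Cn_on_F; apply: Cn_on_mul; last exact: Cn_on_cst.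
by apply: Cn_on_mul; [exact: Cn_on_x|exact: Cn_on_invsqrt].
Qed.

End SmoothCalculus.

Lemma continuous_sum_at {R : realType} {T : topologicalType} n
    (f : 'I_n -> T -> R) (x : T) :
  (forall i, {for x, continuous (f i)}) ->
  {for x, continuous (fun y => \sum_(i < n) f i y)}.
Proof.
move=> cf; apply: (@cvg_big _ _ +%R 0 xpredT _ T (nbhs x) _ f) => // [|i _].
  exact: add_continuous.
exact: cf.
Qed.

Section StefanProblem.
Context {R : realType} {m : nat} (u a k d : nat -> R).
Implicit Types (xi : 'rV[R]_m) (i : nat).
Hypotheses (m_ge1 : (1 <= m)%N)
    (u01 : u 0%N <= u 1%N)
    (u_incr : forall i, (1 <= i <= m)%N -> u i < u i.+1)
    (a_gt0 : forall i, (i <= m)%N -> 0 < a i)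
    (k_gt0 : forall i, (i <= m)%N -> 0 < k i)
    (d_ge0 : forall i, (1 <= i <= m)%N -> 0 <= d i)
    (d1_gt0 : u 0%N = u 1%N -> 0 < d 1%N).

(** * The function E: convexity, coercivity, critical points *)

Section Energy.
Implicit Types x y : 'rV[R]_m.

Definition weight i : R := k i * (u i.+1 - u i).

Definition gap i x : R := Fa a i (xi_ x i) - Fa a i (xi_ x i.+1).

(** Up to a sign for the second one, [warm_slope] and [cold_slope] are the
    partial derivatives of ln (gap i) in the ends xi_i and xi_(i+1) of phase i.
    The end xi_0 = +oo of phase 0 does not move, whence the value 0. *)
Definition warm_slope i x : R :=
  if i == 0%N then 0 else F' (coord x i / a i) / a i / gap i x.

Definition cold_slope i x : R := F' (coord x i.+1 / a i) / a i / gap i x.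

(** The partial derivative of E in xi_i, the common end of the phases i and
    i - 1. *)
Definition gradE i x : R :=
  d i * coord x i / 2 - weight i * warm_slope i x
  + weight i.-1 * cold_slope i.-1 x.

Lemma weight_gt0 i : (1 <= i <= m)%N -> 0 < weight i.
Proof.
move=> im; rewrite mulr_gt0 ?subr_gt0 ?u_incr ?k_gt0//.
by case/andP: im.
Qed.

Lemma weight_ge0 i : (i <= m)%N -> 0 <= weight i.
Proof.
case: i => [|i] im; last by rewrite ltW ?weight_gt0.
by rewrite mulr_ge0 ?subr_ge0// ltW ?k_gt0.
Qed.

Lemma FaE i (r : R) : Fa a i r%:E = F (r / a i)%:E.
Proof. by []. Qed.

Lemma Fa_oo i : (i <= m)%N -> Fa a i +oo = 1.
Proof. by move=> im; rewrite /Fa gt0_mulye// lte_fin invr_gt0 a_gt0. Qed.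

Lemma gap0 x : gap 0 x = 1 - F (coord x 1 / a 0)%:E.
Proof. by rewrite /gap xi_0 Fa_oo// xi_E// FaE. Qed.

Lemma gapE i x : (1 <= i <= m)%N ->
  gap i x = F (coord x i / a i)%:E - F (coord x i.+1 / a i)%:E.
Proof.
by move=> /andP[i1 im]; rewrite /gap !xi_E ?FaE//= ?ltnS ?i1 ?(leqW im) ?im.
Qed.

Lemma div_a_ge0 i j x : Omega x -> (i <= m)%N -> (1 <= j <= m.+1)%N ->
  0 <= coord x j / a i.
Proof. by move=> xO im jm; rewrite divr_ge0 ?(Omega_ge0 xO)// ltW ?a_gt0. Qed.

Lemma div_a_lt i x : Omega x -> (1 <= i <= m)%N ->
  coord x i.+1 / a i < coord x i / a i.
Proof.
move=> /OmegaP xO im; rewrite ltr_pM2r ?xO// invr_gt0 a_gt0//.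
by case/andP: im.
Qed.

Lemma gap_gt0 i x : Omega x -> (i <= m)%N -> 0 < gap i x.
Proof.
case: i => [|i] xO im; first by rewrite gap0 subr_gt0 F_lt1.
by rewrite gapE// subr_gt0 F_lt// div_a_lt.
Qed.

Lemma gap_le1 i x : Omega x -> (i <= m)%N -> gap i x <= 1.
Proof.
case: i => [|i] xO im.
  by rewrite gap0 lerBlDr lerDl -F0 F_le// div_a_ge0.
rewrite gapE// lerBlDr; apply: (le_trans (ltW (F_lt1 _))).
by rewrite lerDl -F0 F_le// div_a_ge0//= ltnS.
Qed.

Lemma ln_gap_gradient i x y : Omega x -> Omega y -> (i <= m)%N ->
  ln (gap i y) <= ln (gap i x) + warm_slope i x * (coord y i - coord x i)
                  - cold_slope i x * (coord y i.+1 - coord x i.+1).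
Proof.
move=> xO yO im; have ai0 : a i != 0 by rewrite gt_eqF ?a_gt0.
have gx0 : gap i x != 0 by rewrite gt_eqF ?gap_gt0.
case: i im ai0 gx0 => [|i] im ai0 gx0.
  have x0 : 0 <= coord x 1 / a 0 by exact: div_a_ge0.
  have y0 : 0 <= coord y 1 / a 0 by exact: div_a_ge0.
  have := ln_F_gradient_oo x0 y0; rewrite -!gap0.
  rewrite (_ : _ / gap 0 x = cold_slope 0 x * (coord y 1 - coord x 1)); last first.
    by rewrite /cold_slope; field; rewrite ?ai0 ?gx0.
  by rewrite /warm_slope /= mul0r addr0.
have im1 : (1 <= i.+1 <= m)%N by [].
have i2 : (1 <= i.+2 <= m.+1)%N by [].
have := ln_F_gradient_le (div_a_ge0 xO im i2) (div_a_lt xO im1)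
                         (div_a_ge0 yO im i2) (div_a_lt yO im1).
rewrite -!gapE//.
rewrite (_ : (_ - _) / gap i.+1 x = warm_slope i.+1 x * (coord y i.+1 - coord x i.+1)
    - cold_slope i.+1 x * (coord y i.+2 - coord x i.+2)) ?addrA//.
by rewrite /cold_slope /warm_slope /=; field; rewrite ?ai0 ?gx0.
Qed.

Lemma ln_gap_gradient_lt i x y : Omega x -> Omega y -> (1 <= i <= m)%N ->
  coord x i != coord y i ->
  ln (gap i y) < ln (gap i x) + warm_slope i x * (coord y i - coord x i)
                  - cold_slope i x * (coord y i.+1 - coord x i.+1).
Proof.
case: i => // i xO yO im neq; have ai0 : a i.+1 != 0 by rewrite gt_eqF ?a_gt0.
have gx0 : gap i.+1 x != 0 by rewrite gt_eqF ?gap_gt0.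
have im1 : (1 <= i.+1 <= m)%N by [].
have i2 : (1 <= i.+2 <= m.+1)%N by [].
have := ln_F_gradient_lt (div_a_ge0 xO im i2) (div_a_lt xO im1)
                         (div_a_ge0 yO im i2) (div_a_lt yO im1).
rewrite -!gapE//.
rewrite (_ : (_ - _) / gap i.+1 x = warm_slope i.+1 x * (coord y i.+1 - coord x i.+1)
    - cold_slope i.+1 x * (coord y i.+2 - coord x i.+2)) ?addrA//.
  apply; apply/orP; left; apply: contra neq => /eqP/(mulIf (invr_neq0 ai0)) ->//.
by rewrite /cold_slope /warm_slope /=; field; rewrite ?ai0 ?gx0.
Qed.

Lemma energyE x : E u a k d x =
  \sum_(0 <= i < m.+1) - (weight i * ln (gap i x))
  + \sum_(1 <= i < m.+1) d i * coord x i ^+ 2 / 4.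
Proof. by rewrite /E sumrN. Qed.

(** Regroups a sum over the lines as a sum over the phases: each phase has two
    ends, and the fixed ends xi_0 and xi_(m+1) contribute 0. *)
Lemma sum_gradE x y :
  \sum_(1 <= i < m.+1) gradE i x * (coord y i - coord x i) =
  \sum_(1 <= i < m.+1) d i * coord x i / 2 * (coord y i - coord x i)
  - \sum_(0 <= i < m.+1) weight i * (warm_slope i x * (coord y i - coord x i)
                  - cold_slope i x * (coord y i.+1 - coord x i.+1)).
Proof.
under [X in _ = _ - X]eq_bigr do rewrite mulrBr.
rewrite sumrB [X in _ = _ - (X - _)]big_nat_recl// [X in _ = _ - (_ - X)]big_nat_recr//=.
rewrite {2}/warm_slope/= mul0r mulr0 add0r !coord_last subrr mulr0 mulr0 addr0.
rewrite !big_add1 /= opprB -sumrB -big_split/=; apply: eq_bigr => i _.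
by rewrite /gradE /warm_slope /=; ring.
Qed.

(** The difference of the sides is the sum of nonnegative defects: A i for the
    logarithm of phase i, B i for the square of xi_i. If x and y differ in the
    coordinate i >= 1, then A i > 0, whatever the weight of phase 0. *)
Lemma E_gradient_lt x y : Omega x -> Omega y -> x != y ->
  E u a k d x + \sum_(1 <= i < m.+1) gradE i x * (coord y i - coord x i)
  < E u a k d y.
Proof.
move=> xO yO xy; rewrite !energyE sum_gradE -subr_gt0.
pose A i := weight i * (ln (gap i x) + warm_slope i x * (coord y i - coord x i)
                  - cold_slope i x * (coord y i.+1 - coord x i.+1) - ln (gap i y)).
pose B i := d i * (coord y i - coord x i) ^+ 2 / 4.
rewrite [X in 0 < X](_ : _ =
    \sum_(0 <= i < m.+1) A i + \sum_(1 <= i < m.+1) B i); last first.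
  rewrite (_ : \sum_(0 <= i < m.+1) A i =
     \sum_(0 <= i < m.+1) - (weight i * ln (gap i y))
     - \sum_(0 <= i < m.+1) - (weight i * ln (gap i x))
     + \sum_(0 <= i < m.+1) weight i * (warm_slope i x * (coord y i - coord x i)
                  - cold_slope i x * (coord y i.+1 - coord x i.+1))); last first.
    by rewrite -sumrB -big_split/=; apply: eq_bigr => i _; rewrite /A; ring.
  rewrite (_ : \sum_(1 <= i < m.+1) B i =
     \sum_(1 <= i < m.+1) d i * coord y i ^+ 2 / 4
     - \sum_(1 <= i < m.+1) d i * coord x i ^+ 2 / 4
     - \sum_(1 <= i < m.+1) d i * coord x i / 2 * (coord y i - coord x i)); last first.
    by rewrite -!sumrB/=; apply: eq_bigr => i _; rewrite /B; field.
  ring.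
have [j xyj] : exists j, x ord0 j != y ord0 j.
  apply/existsP; apply: contraNT xy; rewrite negb_exists => /forallP h.
  by apply/eqP/rowP => j; apply/eqP; rewrite -[_ == _]negbK.
have Age0 i : (i <= m)%N -> 0 <= A i.
  by move=> im; rewrite mulr_ge0 ?weight_ge0// subr_ge0 ln_gap_gradient.
(* The index j of the row vector counts from 0: phase j + 1 is the strict one. *)
rewrite ltr_pwDl//.
  rewrite big_mkord (bigD1 (lift ord0 j))//= ltr_pwDl//.
    rewrite /bump /= add1n mulr_gt0 ?weight_gt0//= ?ltn_ord//.
    by rewrite subr_gt0 ln_gap_gradient_lt//= ?ltn_ord// !coord_ord.
  by apply: sumr_ge0 => i _; rewrite Age0// -ltnS.
rewrite big_add1 big_mkord; apply: sumr_ge0 => i _.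
by rewrite divr_ge0// mulr_ge0 ?sqr_ge0// d_ge0//= ltn_ord.
Qed.

(** In the combination, with weights s and 1 - s, of the tangent inequalities
    at z towards x and towards y, the linear terms cancel. *)
Lemma strictly_convex_E : strictly_convex_on (@Omega R m) (E u a k d).
Proof.
split=> [|x y s xO yO xy /andP[s0 s1]]; first exact: convex_Omega.
set z := _ + _.
have zO : Omega z.
  apply/OmegaP => i im; rewrite !coordD !coordZ.
  rewrite ltrD// ltr_pM2l ?((OmegaP _).1 xO) ?((OmegaP _).1 yO)//.
  by rewrite subr_gt0.
have zx : z - x = (1 - s) *: (y - x).
  by apply/rowP => j; rewrite !mxE; ring.
have zy : z - y = s *: (x - y).
  by apply/rowP => j; rewrite !mxE; ring.
have s10 : 1 - s != 0 by rewrite subr_eq0 eq_sym lt_eqF.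
have nzx : z != x by rewrite -subr_eq0 zx scaler_eq0 (negPf s10) subr_eq0 eq_sym.
have nzy : z != y by rewrite -subr_eq0 zy scaler_eq0 gt_eqF//= subr_eq0.
have hx := E_gradient_lt zO xO nzx; have hy := E_gradient_lt zO yO nzy.
have s1' : 0 < 1 - s by rewrite subr_gt0.
rewrite -(ltr_pM2l s0) in hx; rewrite -(ltr_pM2l s1') in hy.
pose S (w : 'rV[R]_m) := \sum_(1 <= i < m.+1) gradE i z * (coord w i - coord z i).
rewrite -[ltLHS](_ : s * (E u a k d z + S x) + (1 - s) * (E u a k d z + S y) = _).
  exact: ltrD.
have comb (e S1 S2 : R) : s * (e + S1) + (1 - s) * (e + S2) = e + (s * S1 + (1 - s) * S2).
  by ring.
rewrite comb /S !mulr_sumr -big_split/= big1 ?addr0// => i _.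
rewrite /z !coordD !coordZ; ring.
Qed.

Lemma continuous_gap i x : (i <= m)%N -> {for x, continuous (gap i)}.
Proof.
have cF j : {for x, continuous (fun y => F (coord y j / a i)%:E)}.
  apply: (@continuous_comp _ _ _ (fun y => coord y j / a i) (fun z => F z%:E)).
    by apply: continuousM; [exact: continuous_coord|exact: cst_continuous].
  exact: continuous_F.
case: i cF => [|i] cF im.
  rewrite (_ : gap 0 = fun y => 1 - F (coord y 1 / a 0)%:E).
    by apply: continuousB; [exact: cst_continuous|exact: cF].
  by apply/funext => y; rewrite gap0.
rewrite (_ : gap i.+1 =
    fun y => F (coord y i.+1 / a i.+1)%:E - F (coord y i.+2 / a i.+1)%:E).
  by apply: continuousB; exact: cF.
by apply/funext => y; rewrite gapE.
Qed.

Lemma continuous_E x : Omega x -> {for x, continuous (E u a k d : 'rV[R]_m -> R)}.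
Proof.
move=> xO; rewrite (_ : E u a k d = fun y : 'rV_m =>
    \sum_(i < m.+1) - (weight i * ln (gap i y))
    + \sum_(i < m) d i.+1 * coord y i.+1 ^+ 2 / 4); last first.
  by apply/funext => y; rewrite energyE big_mkord big_add1 big_mkord.
apply: continuousD; apply: continuous_sum_at => i.
- apply: continuousN; apply: continuousM; first exact: cst_continuous.
  apply: (@continuous_comp _ _ _ (gap i) (@ln R)).
    by apply: continuous_gap; rewrite -ltnS.
  by apply: continuous_ln; rewrite gap_gt0// -ltnS.
- apply: continuousM; last exact: cst_continuous.
  apply: continuousM; first exact: cst_continuous.
  apply: (@continuous_comp _ _ _ (fun y => coord y i.+1) (fun z => z ^+ 2)).
    exact: continuous_coord.
  exact: exprn_continuous.
Qed.

Lemma continuous_gradE i x : Omega x -> (1 <= i <= m)%N ->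
  {for x, continuous (gradE i)}.
Proof.
case: i => // i xO im.
have cslope l j : (l <= m)%N -> {for x, continuous
    (fun y : 'rV_m => F' (coord y j / a l) / a l / gap l y)}.
  move=> lm; apply: continuousM; last first.
    by apply: continuousV; [rewrite gt_eqF ?gap_gt0|exact: continuous_gap].
  apply: continuousM; last exact: cst_continuous.
  apply: (@continuous_comp _ _ _ (fun y => coord y j / a l) F').
    by apply: continuousM; [exact: continuous_coord|exact: cst_continuous].
  exact: continuous_F'.
have c0 : {for x, continuous (fun y : 'rV_m => d i.+1 * coord y i.+1 / 2)}.
  apply: continuousM; last exact: cst_continuous.
  by apply: continuousM; [exact: cst_continuous|exact: continuous_coord].
have cw (w : R) l j : (l <= m)%N -> {for x, continuous
    (fun y : 'rV_m => w * (F' (coord y j / a l) / a l / gap l y))}.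
  by move=> lm; apply: continuousM; [exact: cst_continuous|exact: cslope].
exact: continuousD (continuousB c0 (cw _ _ i.+1 im)) (cw _ _ i.+1 (ltnW im)).
Qed.

(** Since 0 < gap <= 1, no term of E is negative. *)
Lemma E_terms_le (c : R) x : Omega x -> E u a k d x <= c ->
  (forall i, (i <= m)%N -> - (weight i * ln (gap i x)) <= c) /\
  (forall i, (1 <= i <= m)%N -> d i * coord x i ^+ 2 / 4 <= c).
Proof.
move=> xO; rewrite energyE big_mkord big_add1 big_mkord /= => Ec.
have A0 (i : 'I_m.+1) : 0 <= - (weight i * ln (gap i x)).
  have im : (i <= m)%N by rewrite -ltnS.
  rewrite oppr_ge0; apply: mulr_ge0_le0.
    exact: weight_ge0.
  by apply: ln_le0; exact: gap_le1.
have B0 (i : 'I_m) : 0 <= d i.+1 * coord x i.+1 ^+ 2 / 4.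
  by rewrite divr_ge0// mulr_ge0 ?sqr_ge0 ?d_ge0//= ltn_ord.
split=> [i im|[//|i] im].
  apply: le_trans Ec; rewrite (bigD1 (Ordinal (im : (i < m.+1)%N)))//= -addrA lerDl.
  by rewrite addr_ge0// sumr_ge0.
apply: le_trans Ec; rewrite [X in _ + X](bigD1 (Ordinal (im : (i < m)%N)))//= addrCA lerDl.
by rewrite addr_ge0// sumr_ge0.
Qed.

Lemma gap_lower_bound (c : R) i x : Omega x -> E u a k d x <= c ->
  (i <= m)%N -> 0 < weight i -> expR (- (c / weight i)) <= gap i x.
Proof.
move=> xO /(E_terms_le xO)[+ _] im w0 => /(_ i im).
rewrite -mulrN mulrC -ler_pdivlMr// => h.
by rewrite -[leRHS]lnK ?posrE ?gap_gt0// ler_expR -lerN2 opprK.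
Qed.

(** F is Lipschitz with constant 1 / sqrt pi, so a lower bound on the gap of a
    phase keeps the two lines that bound it apart. *)
Lemma gap_le i x : Omega x -> (1 <= i <= m)%N ->
  a i * Num.sqrt pi * gap i x <= coord x i - coord x i.+1.
Proof.
move=> xO im; have /andP[i1 im'] := im.
have [c _ e] := F_MVT (div_a_lt xO im).
have p0 : 0 < Num.sqrt (@pi R) by rewrite sqrtr_gt0 pi_gt0.
have ai0 := a_gt0 im'.
rewrite gapE// e -mulrBl; set D := coord x i - coord x i.+1.
have D0 : 0 < D by rewrite subr_gt0; exact: ((OmegaP x).1 xO).
rewrite (_ : _ * _ * _ = Num.sqrt pi * F' c * D); last by field; rewrite gt_eqF.
apply: ler_piMl; first exact: ltW.
by rewrite -ler_pdivlMl// mulr1; exact: F'_le.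
Qed.

Lemma coord_le1 i x : Omega x -> (1 <= i <= m)%N -> coord x i <= coord x 1.
Proof.
move=> /OmegaP xO; elim: i => // -[//|i] IH im.
by apply: le_trans (IH _); [apply/ltW/xO => /=; exact: ltnW|exact: ltnW].
Qed.

(** If u_0 < u_1, the term of phase 0 keeps F (xi_1 / a_0) away from its limit
    1; if u_0 = u_1, this term vanishes and d_1 xi_1 ^ 2 / 4 takes over. *)
Lemma E_coord_bounded (c : R) : exists M : R, forall x,
  Omega x -> E u a k d x <= c -> coord x 1 <= M.
Proof.
have a0 := a_gt0 (leq0n m).
move: u01; rewrite le_eqVlt => /predU1P[/d1_gt0 d1|u01'].
  exists (`|4 * c / d 1| + 1) => x xO Ec.
  have [_ /(_ 1%N)] := E_terms_le xO Ec.
  rewrite m_ge1 => /(_ isT) h.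
  (* y ^ 2 <= b forces y <= b + 1; the absolute value spares the sign of c. *)
  have {}h : coord x 1 ^+ 2 <= `|4 * c / d 1|.
    apply: le_trans (ler_norm _); rewrite ler_pdivlMr//; lra.
  rewrite leNgt; apply/negP => h1.
  have n0 := normr_ge0 (4 * c / d 1).
  nra.
have w0 : 0 < weight 0 by rewrite mulr_gt0 ?k_gt0 ?subr_gt0.
near (pinfty_nbhs R) => N; exists (N * a 0) => x xO Ec.
rewrite -ler_pdivrMr// leNgt; apply/negP => /F_lt h.
have := gap_lower_bound xO Ec (leq0n m) w0; rewrite gap0// => h1.
have : 1 - expR (- (c / weight 0)) < F N%:E.
  by near: N; apply: (cvgr_gt 1 F_cvg1); rewrite ltrBlDr ltrDl expR_gt0.
lra.
Unshelve. all: by end_near. Qed.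

(** A sublevel set lies in the box [0, M] ^ m. It is closed: the distances
    between successive lines are at least delta_i > 0 on it, hence also at its
    limit points, which thus belong to Omega, where E is continuous. *)
Lemma coercive_E : coercive_on (@Omega R m) (E u a k d).
Proof.
move=> c c0; have [M EM] := E_coord_bounded c.
set K := [set x | _].
have boxc : compact [set v : 'rV[R]_m | forall i : 'I_m, [set` `[0, M]] (v ord0 i)].
  exact: (@rV_compact R m (fun=> [set` `[0, M]]) (fun=> @segment_compact R 0 M)).
apply: subclosed_compact boxc _; last first.
  move=> x [xO Ec] i /=; rewrite in_itv/= -coord_ord.
  have im : (1 <= i.+1 <= m)%N by rewrite /= ltn_ord.
  have im1 : (1 <= i.+1 <= m.+1)%N by rewrite /= (leqW (ltn_ord i)).
  apply/andP; split; first exact: Omega_ge0 im1.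
  exact: le_trans (coord_le1 xO im) (EM _ xO Ec).
move=> x xK; pose delta i := a i * Num.sqrt pi * expR (- (c / weight i)).
have delta0 i : (1 <= i <= m)%N -> 0 < delta i.
  move=> /andP[_ im]; rewrite /delta mulr_gt0 ?expR_gt0// mulr_gt0 ?a_gt0//.
  by rewrite sqrtr_gt0 pi_gt0.
have Kdelta y i : K y -> (1 <= i <= m)%N -> delta i <= coord y i - coord y i.+1.
  move=> [yO Ec] im; apply: le_trans (gap_le yO im).
  have /andP[_ im'] := im.
  rewrite ler_pM2l ?mulr_gt0 ?a_gt0 ?sqrtr_gt0 ?pi_gt0//.
  by apply: gap_lower_bound => //; exact: weight_gt0.
have xO : Omega x.
  apply/OmegaP => i im; rewrite -subr_gt0; apply: lt_le_trans (delta0 _ im) _.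
  rewrite leNgt; apply/negP => h.
  have cc : {for x, continuous (fun y => coord y i - coord y i.+1)}.
    by apply: continuousB; exact: continuous_coord.
  have [y [yK /=]] := xK _ (cvgr_lt _ cc _ h).
  by rewrite ltNge Kdelta.
split=> //; rewrite leNgt; apply/negP => h.
have [y [[_ yc] /=]] := xK _ (cvgr_gt _ (continuous_E xO) _ h).
by rewrite ltNge yc.
Qed.

Lemma Omega_nonempty : @Omega R m !=set0.
Proof.
exists (\row_i (m - i)%:R); apply/OmegaP => -[//|i] /= im.
rewrite (coord_nat _ im) mxE /=.
move: im; rewrite leq_eqVlt => /predU1P[im|im].
  by rewrite im coord_last ltr0n subn_gt0 -im.
by rewrite (coord_nat _ im) mxE/= ltr_nat ltn_sub2l// ltnW.
Qed.

Lemma E_has_min :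
  exists2 x : 'rV[R]_m, Omega x & forall y : 'rV[R]_m, Omega y -> E u a k d x <= E u a k d y.
Proof.
have [p pO] := Omega_nonempty.
pose c := `|E u a k d p| + 1.
have c0 : 0 < c by rewrite /c; apply: ltr_wpDl.
have pc : E u a k d p <= c by apply: le_trans (ler_norm _) _; rewrite lerDl.
have [||x] := @EVT_min_rV R m (E u a k d) _ _ (coercive_E c0).
- by exists p.
- by apply: continuous_in_subspaceT => x; rewrite inE => -[xO _]; exact: continuous_E.
rewrite inE => -[xO Ex] xmin; exists x => // y yO.
have [yc|yc] := leP (E u a k d y) c; first by apply: xmin; rewrite inE.
exact: le_trans Ex (ltW yc).
Qed.

Lemma E_gradient_le x y : Omega x -> Omega y ->
  E u a k d x + \sum_(1 <= i < m.+1) gradE i x * (coord y i - coord x i)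
  <= E u a k d y.
Proof.
move=> xO yO; have [->|xy] := eqVneq x y; last exact/ltW/E_gradient_lt.
by rewrite big1 ?addr0// => i _; rewrite subrr mulr0.
Qed.

Lemma critical_lt x y : Omega x -> (forall i, (1 <= i <= m)%N -> gradE i x = 0) ->
  Omega y -> y != x -> E u a k d x < E u a k d y.
Proof.
move=> xO g0 yO yx; have := E_gradient_lt xO yO; rewrite eq_sym => /(_ yx).
rewrite big_nat big1 ?addr0// => i im.
by rewrite g0// mul0r.
Qed.

Lemma nbhs_Omega x : Omega x -> nbhs x (@Omega R m).
Proof.
move=> xO.
have : \forall y \near x, forall j : 'I_m, coord y j.+2 < coord y j.+1.
  apply: (@filter_forall _ _ (fun (j : 'I_m) y => coord y j.+2 < coord y j.+1)
    (nbhs x) (nbhs_filter x)) => j.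
  have cc : {for x, continuous (fun y => coord y j.+1 - coord y j.+2)}.
    by apply: continuousB; exact: continuous_coord.
  have : 0 < coord x j.+1 - coord x j.+2.
    by rewrite subr_gt0; apply: ((OmegaP x).1 xO) => /=.
  move=> /(cvgr_gt _ cc); apply: filterS => y /=.
  by rewrite subr_gt0.
apply: filterS => y h; apply/OmegaP => -[//|i] im.
exact: (h (Ordinal (im : (i < m)%N))).
Qed.

(** For y = x + h e_i, the tangent inequality at y reads
    E y - h * gradE i y <= E x <= E y, so that h * gradE i y >= 0. Now h tends
    to 0 from either side. *)
Lemma min_critical x : Omega x -> (forall y, Omega y -> E u a k d x <= E u a k d y) ->
  forall i, (1 <= i <= m)%N -> gradE i x = 0.
Proof.
move=> xO xmin [//|i] im.
pose e : 'rV[R]_m := delta_mx ord0 (Ordinal (im : (i < m)%N)).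
pose y (h : R) := x + h *: e.
have cy : {for 0, continuous y}.
  apply: continuousD; first exact: cst_continuous.
  by apply: continuousZ; [exact: cvg_id|exact: cst_continuous].
have y0 : y 0 = x by rewrite /y scale0r addr0.
have yO : \forall h \near 0, Omega (y h).
  by apply: cy; rewrite y0; exact: nbhs_Omega.
have cg : {for 0, continuous (fun h => gradE i.+1 (y h))}.
  apply: (@continuous_comp _ _ _ y (gradE i.+1)) => //.
  by rewrite y0; exact: continuous_gradE.
have slope h : Omega (y h) -> 0 <= h * gradE i.+1 (y h).
  move=> hO; have := E_gradient_le hO xO; rewrite -lerBrDl => /le_trans/(_ _).
  have -> : \sum_(1 <= l < m.+1) gradE l (y h) * (coord x l - coord (y h) l)
      = - (h * gradE i.+1 (y h)).
    rewrite big_add1 big_mkord (bigD1 (Ordinal (im : (i < m)%N)))//= big1 ?addr0.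
      rewrite coordD coordZ (coord_nat _ im) (coord_nat _ im) mxE !eqxx/=.
      ring.
    move=> l li; rewrite coordD coordZ coord_ord coord_ord mxE eqxx (negPf li)/=.
    ring.
  by move=> /(_ 0); rewrite oppr_le0; apply; rewrite subr_le0 xmin.
apply/eqP; rewrite eq_le; apply/andP; split.
  have cl := cvg_at_left_filter cg; rewrite y0 in cl.
  apply: (cvgr_to_le cl); near=> h.
  have h0 : h < 0 by [].
  have : Omega (y h) by near: h; exact: cvg_within yO.
  by move=> /slope; rewrite nmulr_rge0.
have cr := cvg_at_right_filter cg; rewrite y0 in cr.
apply: (cvgr_to_ge cr); near=> h.
have h0 : 0 < h by [].
have : Omega (y h) by near: h; exact: cvg_within yO.
by move=> /slope; rewrite pmulr_rge0.
Unshelve. all: by end_near. Qed.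

End Energy.

(** * Profiles within the phases *)

Definition in_phase xi i (z : R) : Prop := (xi_ xi i.+1 < z%:E < xi_ xi i)%E.

Definition profile_slope xi i : R :=
  (u i.+1 - u i) / (Fa a i (xi_ xi i.+1) - Fa a i (xi_ xi i)).

Definition profile xi i (z : R) : R :=
  u i + profile_slope xi i * (Fa a i z%:E - Fa a i (xi_ xi i)).

Lemma in_phaseP xi i z : (i <= m)%N ->
  in_phase xi i z <-> coord xi i.+1 < z /\ (i = 0%N \/ z < coord xi i).
Proof.
move=> im; rewrite /in_phase xi_E//=.
case: i im => [|i] im.
  by rewrite xi_0 ltry andbT lte_fin; split=> [?|[]//]; split=> //; left.
rewrite xi_E/= ?(leqW im)// !lte_fin; split=> [/andP[-> ->]|[-> [//|->//]]].
by split=> //; right.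
Qed.

Definition lines xi : nat -> R -> R := fun i t => coord xi i * Num.sqrt t.

Lemma phaseP xi i p : (i <= m)%N ->
  phase m (lines xi) i p <-> 0 < p.1 /\ in_phase xi i (p.2 / Num.sqrt p.1).
Proof.
move=> im; rewrite /phase /=.
suff eqv : 0 < p.1 ->
    (ext m ((lines xi)^~ p.1) i.+1 < p.2%:E < ext m ((lines xi)^~ p.1) i)%E
    <-> in_phase xi i (p.2 / Num.sqrt p.1).
  by split=> -[p0 h]; split=> //; apply/eqv.
move=> p0; have s0 : 0 < Num.sqrt p.1 by rewrite sqrtr_gt0.
rewrite in_phaseP// /lines.
have -> : ext m ((fun i t => coord xi i * Num.sqrt t)^~ p.1) i.+1 =
    (coord xi i.+1 * Num.sqrt p.1)%:E.
  rewrite /ext /=; case: ltnP => // mi; have -> : i = m by apply/eqP; rewrite eqn_leq im.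
  by rewrite coord_last mul0r.
rewrite lte_fin -ltr_pdivlMr// /ext.
case: eqVneq => [->|i0]; first by rewrite ltry andbT; split=> [?|[]//]; split=> //; left.
rewrite im lte_fin -(ltr_pdivrMr _ _ s0); split=> [/andP[-> ->]|[-> [/eqP|->//]]].
  by split=> //; right.
by rewrite (negPf i0).
Qed.

Lemma open_in_phase xi i : (i <= m)%N -> open (in_phase xi i).
Proof.
move=> im; rewrite (_ : in_phase xi i = [set z | coord xi i.+1 < z] `&`
   [set z | i = 0%N \/ z < coord xi i]); last first.
  by apply/seteqP; split=> z /in_phaseP; apply.
apply: openI; first exact: open_gt.
case: (eqVneq i 0%N) => [->|i0].
  rewrite (_ : [set z | _] = setT); first exact: openT.
  by apply/seteqP; split=> // z _; left.
rewrite (_ : [set z | _] = [set z | z < coord xi i]); first exact: open_lt.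
by apply/seteqP; split=> z /=; [case=> // /eqP; rewrite (negPf i0)|right].
Qed.

Lemma continuous_similarity (p : R * R) : 0 < p.1 ->
  {for p, continuous (fun q : R * R => q.2 / Num.sqrt q.1)}.
Proof.
move=> p0; apply: continuousM; first exact: cvg_snd.
apply: (@continuous_comp _ _ _ fst (fun t : R => (Num.sqrt t)^-1)).
  exact: cvg_fst.
exact: is_derive_continuous (is_derive_invsqrt p0).
Qed.

Lemma open_phase xi i : (i <= m)%N -> open (phase m (lines xi) i).
Proof.
move=> im; rewrite openE => p /(phaseP _ _ im)[p0 pi].
have n1 : \forall q \near p, 0 < q.1.
  have : nbhs p.1 [set t | 0 < t] by apply: open_nbhs_nbhs; split=> //; exact: open_gt.
  exact: cvg_fst.
have n2 : \forall q \near p, in_phase xi i (q.2 / Num.sqrt q.1).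
  apply: (continuous_similarity p0); apply: open_nbhs_nbhs; split=> //.
  exact: open_in_phase.
by rewrite /interior /=; apply: filterS2 n1 n2 => q q0 qi; apply/phaseP.
Qed.

Lemma Fa_lt i (y : R) (z : \bar R) : (i <= m)%N -> (y%:E < z)%E ->
  Fa a i y%:E < Fa a i z.
Proof.
move=> im; case: z => [z| |//].
  by rewrite lte_fin => yz; rewrite !FaE F_lt// ltr_pM2r// invr_gt0 a_gt0.
by move=> _; rewrite FaE (Fa_oo im) F_lt1.
Qed.

Lemma Fa_le i (y z : \bar R) : (i <= m)%N -> y != -oo%E -> (y <= z)%E -> Fa a i y <= Fa a i z.
Proof.
move=> im; case: y => [y| |//] _; last by rewrite leye_eq => /eqP->.
by rewrite le_eqVlt => /predU1P[->//|/(Fa_lt im)/ltW].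
Qed.

Lemma profile_bounds xi i z : Omega xi -> (i <= m)%N -> in_phase xi i z ->
  u i < profile xi i z < u i.+1 \/ u i = u i.+1 /\ profile xi i z = u i.
Proof.
move=> xO im /andP[z1 z2].
have [uE|un] := eqVneq (u i) (u i.+1).
  by right; split=> //; rewrite /profile /profile_slope uE subrr !mul0r addr0.
have ui : 0 < u i.+1 - u i.
  case: i im un {z1 z2} => [|i] im un; last by rewrite subr_gt0 u_incr.
  by rewrite subr_gt0 lt_neqAle un.
left; have h2 := Fa_lt im z2.
have z1' : Fa a i (xi_ xi i.+1) < Fa a i z%:E.
  by move: z1; rewrite xi_E// lte_fin -lte_fin => /(Fa_lt im).
have g0 := gap_gt0 xO im; rewrite /gap in g0.
rewrite /profile /profile_slope.
set A := Fa a i (xi_ xi i.+1) in z1' g0 *; set B := Fa a i (xi_ xi i) in h2 g0 *.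
set C := Fa a i z%:E in h2 z1' *; clear z1 z2.
have -> : (u i.+1 - u i) / (A - B) * (C - B) = (u i.+1 - u i) * ((B - C) / (B - A)).
  by field; rewrite !subr_eq0; apply/andP; lra.
set q := (B - C) / (B - A).
have q0 : 0 < q by rewrite divr_gt0// subr_gt0.
have q1 : q < 1 by rewrite ltr_pdivrMr// mul1r; lra.
have := mulr_gt0 ui q0; have : (u i.+1 - u i) * q < u i.+1 - u i by rewrite gtr_pMr.
lra.
Qed.

Definition profile' xi i z := profile_slope xi i * F' (z / a i) / a i.

Lemma is_derive_profile xi i (z : R) : is_derive z 1 (profile xi i) (profile' xi i z).
Proof.
have h1 : is_derive z 1 (fun z : R => z / a i) (a i)^-1.
  by apply: is_derive_eq; rewrite /GRing.scale/=; ring.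
have h2 := is_deriveZ (profile_slope xi i)
  (@is_derive1_comp R (fun w : R => F w%:E) (fun z => z / a i) _ _ _ (is_derive_F _) h1).
pose A := u i - profile_slope xi i * Fa a i (xi_ xi i).
have h3 := is_deriveD (is_derive_cst A z 1) h2.
rewrite (_ : profile xi i = fun w => A + profile_slope xi i * F (w / a i)%:E); last first.
  by apply/funext => w; rewrite /profile FaE /A; ring.
apply: (is_derive_eq h3); rewrite /profile' /GRing.scale/=; ring.
Qed.

(** In the variable z = x / sqrt t, the heat equation is
    2 a_i ^ 2 p'' = - z p'. *)
Lemma is_derive_profile' xi i (z : R) : (i <= m)%N ->
  is_derive z 1 (profile' xi i) (- (z / (2 * a i ^+ 2)) * profile' xi i z).
Proof.
move=> im; have ai0 : a i != 0 by rewrite gt_eqF ?a_gt0.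
have h1 : is_derive z 1 (fun z : R => z / a i) (a i)^-1.
  by apply: is_derive_eq; rewrite /GRing.scale/=; ring.
have h2 := is_deriveZ (profile_slope xi i / a i)
  (@is_derive1_comp R F' (fun z => z / a i) _ _ _ (is_derive_F' _) h1).
rewrite (_ : _ \*: _ = profile' xi i) in h2; last first.
  by apply/funext => w; rewrite /profile' /= /GRing.scale/=; ring.
by apply: (is_derive_eq h2); rewrite /profile' /GRing.scale/=; field.
Qed.

(** * The self-similar solutions *)

Section SelfSimilar.
Implicit Types (j : nat) (v : R -> R) (t x y z w : R).

Lemma u_le i j : (i <= j <= m.+1)%N -> u i <= u j.
Proof.
case/andP; elim: j => [|j IH]; first by rewrite leqn0 => /eqP->.
rewrite leq_eqVlt => /predU1P[->//|ij] jm; apply: (le_trans (IH ij (ltnW jm))).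
by case: j jm {IH ij} => // j jm; apply/ltW/u_incr.
Qed.

Lemma in_phase_or_line xi z : 0 < z ->
  (exists2 i, (i <= m)%N & in_phase xi i z) \/
  (exists2 i, (1 <= i <= m)%N & z = coord xi i).
Proof.
move=> z0; have ex : exists i, coord xi i.+1 < z by exists m; rewrite coord_last.
(* For the least i such that xi_(i+1) < z, z lies in phase i or on line i. *)
case: (ex_minnP ex) => i zi imin.
have im : (i <= m)%N by apply: imin; rewrite coord_last.
case: i zi imin im => [|i] zi imin im.
  by left; exists 0%N => //; apply/in_phaseP => //; split=> //; left.
have : ~~ (coord xi i.+1 < z) by apply/negP => /imin; rewrite ltnn.
rewrite -leNgt le_eqVlt => /predU1P[->|zi1].
  by right; exists i.+1.
by left; exists i.+1 => //; apply/in_phaseP => //; split=> //; right.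
Qed.

Section Form.
Variables (xi : 'rV[R]_m) (v : R -> R).
Hypotheses (xO : Omega xi) (vf : selfsimilar_form u a xi v).

Let U t x := v (x / Num.sqrt t).

Lemma form_profile i z : (i <= m)%N -> in_phase xi i z -> v z = profile xi i z.
Proof. by move=> im zi; exact: vf.1. Qed.

Lemma form_near i z : (i <= m)%N -> in_phase xi i z ->
  \forall w \near z, v w = profile xi i w.
Proof.
move=> im zi.
have : nbhs z (in_phase xi i) by apply: open_nbhs_nbhs; split=> //; exact: open_in_phase.
by apply: filterS => w; exact: form_profile.
Qed.

Lemma form_bounds i z : (i <= m)%N -> in_phase xi i z ->
  u i < v z < u i.+1 \/ u i = u i.+1 /\ v z = u i.
Proof. by move=> im zi; rewrite (form_profile im zi); exact: profile_bounds. Qed.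

Lemma form_le i z : (i <= m)%N -> in_phase xi i z -> u i <= v z <= u i.+1.
Proof.
move=> im /(form_bounds im)[/andP[/ltW-> /ltW->]//|[<- ->]].
by rewrite lexx.
Qed.

Lemma form_derive i z : (i <= m)%N -> in_phase xi i z ->
  is_derive z 1 v (profile' xi i z).
Proof.
move=> im zi; apply: near_eq_is_derive (is_derive_profile _ _ _).
by apply: filterS (form_near im zi) => w ->.
Qed.

Lemma form_derive_x i t x : (i <= m)%N -> in_phase xi i (x / Num.sqrt t) ->
  is_derive x 1 (U t) (profile' xi i (x / Num.sqrt t) / Num.sqrt t).
Proof.
move=> im zi.
have h : is_derive x 1 (fun x => x / Num.sqrt t) (Num.sqrt t)^-1.
  by apply: is_derive_eq; rewrite /GRing.scale/=; ring.
exact: (@is_derive1_comp R v (fun x => x / Num.sqrt t) _ _ _ (form_derive im zi) h).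
Qed.

Lemma form_derive_t i t x : (i <= m)%N -> 0 < t -> in_phase xi i (x / Num.sqrt t) ->
  is_derive t 1 (U^~ x)
    (profile' xi i (x / Num.sqrt t) * (x * (- 2^-1 * (Num.sqrt t)^-1 ^+ 3))).
Proof.
move=> im t0 zi; have h := is_deriveZ x (is_derive_invsqrt t0).
exact: (@is_derive1_comp R v (fun t => x / Num.sqrt t) _ _ _ (form_derive im zi) h).
Qed.

Lemma near_in_phase i t x : (i <= m)%N -> in_phase xi i (x / Num.sqrt t) ->
  \forall y \near x, in_phase xi i (y / Num.sqrt t).
Proof.
move=> im zi.
have c : {for x, continuous (fun y => y / Num.sqrt t)}.
  by apply: continuousM; [exact: cvg_id|exact: cst_continuous].
by apply: c; apply: open_nbhs_nbhs; split=> //; exact: open_in_phase.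
Qed.

Lemma form_heat i t x : (i <= m)%N -> 0 < t -> in_phase xi i (x / Num.sqrt t) ->
  dt U t x = a i ^+ 2 * dx (dx U) t x.
Proof.
move=> im t0 zi; have s0 : Num.sqrt t != 0 by rewrite gt_eqF// sqrtr_gt0.
have ai0 : a i != 0 by rewrite gt_eqF ?a_gt0.
have -> : dt U t x = profile' xi i (x / Num.sqrt t) * (x * (- 2^-1 * (Num.sqrt t)^-1 ^+ 3)).
  by rewrite /dt derive1E; have [_ ->] := form_derive_t im t0 zi.
have h : is_derive x 1 (fun x => x / Num.sqrt t) (Num.sqrt t)^-1.
  by apply: is_derive_eq; rewrite /GRing.scale/=; ring.
have h1 := @is_derive1_comp R (profile' xi i) (fun x => x / Num.sqrt t) _ _ _
  (is_derive_profile' xi (x / Num.sqrt t) im) h.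
have h2 := is_deriveZ (Num.sqrt t)^-1 h1.
have : is_derive x 1 (dx U t) ((Num.sqrt t)^-1 * (- ((x / Num.sqrt t) / (2 * a i ^+ 2))
    * profile' xi i (x / Num.sqrt t) * (Num.sqrt t)^-1)).
  apply: near_eq_is_derive h2.
  apply: filterS (near_in_phase im zi) => y yi.
  by rewrite /dx derive1E; have [_ ->] := form_derive_x im yi; rewrite mulrC.
rewrite {2}/dx derive1E => -[_ ->].
by field; rewrite ?ai0 ?s0.
Qed.

Lemma form_smooth i : (i <= m)%N -> smooth_on (phase m (lines xi) i) U.
Proof.
move=> im n; have oP := @open_phase xi i im.
pose B := profile_slope xi i.
apply: (Cn_on_eq oP (U := fun t x =>
  (u i - B * Fa a i (xi_ xi i)) + B * F (x / Num.sqrt t / a i)%:E)).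
  move=> p /(phaseP _ _ im)[p0 pi].
  by rewrite /U (form_profile im pi) /profile FaE -/B; ring.
by apply: smooth_on_profile => // p /(phaseP _ _ im)[].
Qed.

Lemma near_left_phase i t : (1 <= i <= m)%N -> 0 < t ->
  \forall x \near (coord xi i * Num.sqrt t)^'-, in_phase xi i (x / Num.sqrt t).
Proof.
move=> /andP[i1 im] t0; have s0 : 0 < Num.sqrt t by rewrite sqrtr_gt0.
have := (OmegaP xi).1 xO i; rewrite i1 im => /(_ isT) lt.
near=> x; apply/in_phaseP => //; split; last first.
  by right; rewrite ltr_pdivrMr.
rewrite ltr_pdivlMr//; near: x; apply: nbhs_left_gt.
by rewrite ltr_pM2r.
Unshelve. all: by end_near. Qed.

Lemma near_right_phase i t : (1 <= i <= m)%N -> 0 < t ->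
  \forall x \near (coord xi i * Num.sqrt t)^'+, in_phase xi i.-1 (x / Num.sqrt t).
Proof.
case: i => // i im t0; have s0 : 0 < Num.sqrt t by rewrite sqrtr_gt0.
case: i im => [|i] im; near=> x.
  by apply/in_phaseP => //; split; [rewrite ltr_pdivlMr|left].
apply/in_phaseP => /=; first exact: ltnW.
split; first by rewrite ltr_pdivlMr.
right; rewrite ltr_pdivrMr//; near: x; apply: nbhs_right_lt.
by rewrite ltr_pM2r//; apply: ((OmegaP xi).1 xO); rewrite /= ltnW.
Unshelve. all: by end_near. Qed.

Lemma continuous_dx_profile i t (x0 : R) : (i <= m)%N ->
  {for x0, continuous (fun x => profile' xi i (x / Num.sqrt t) / Num.sqrt t)}.
Proof.
move=> im.
have c : {for x0, continuous (fun y => y / Num.sqrt t)}.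
  by apply: continuousM; [exact: cvg_id|exact: cst_continuous].
apply: continuousM; last exact: cst_continuous.
apply: (@continuous_comp _ _ _ (fun y => y / Num.sqrt t)) => //.
exact: is_derive_continuous (is_derive_profile' xi _ im).
Qed.

Lemma cvg_warm i t : (1 <= i <= m)%N -> 0 < t ->
  dx U t x @[x --> (coord xi i * Num.sqrt t)^'-] -->
    profile' xi i (coord xi i) / Num.sqrt t.
Proof.
move=> im t0; have /andP[_ im'] := im.
have s0 : Num.sqrt t != 0 by rewrite gt_eqF// sqrtr_gt0.
have := cvg_at_left_filter (@continuous_dx_profile i t (coord xi i * Num.sqrt t) im').
rewrite mulfK//; apply: cvg_trans; apply: near_eq_cvg.
apply: filterS (near_left_phase im t0) => x xi'.
by rewrite /dx derive1E; have [_ ->] := form_derive_x im' xi'.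
Qed.

Lemma cvg_cold i t : (1 <= i <= m)%N -> 0 < t ->
  dx U t x @[x --> (coord xi i * Num.sqrt t)^'+] -->
    profile' xi i.-1 (coord xi i) / Num.sqrt t.
Proof.
move=> im t0; have im' : (i.-1 <= m)%N by case/andP: im => _ /(leq_trans (leq_pred _)).
have s0 : Num.sqrt t != 0 by rewrite gt_eqF// sqrtr_gt0.
have := cvg_at_right_filter (@continuous_dx_profile i.-1 t (coord xi i * Num.sqrt t) im').
rewrite mulfK//; apply: cvg_trans; apply: near_eq_cvg.
apply: filterS (near_right_phase im t0) => x xi'.
by rewrite /dx derive1E; have [_ ->] := form_derive_x im' xi'.
Qed.

Lemma is_derive_lines i t : 0 < t ->
  is_derive t 1 (lines xi i) (coord xi i / (2 * Num.sqrt t)).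
Proof. by move=> t0; exact: (is_deriveZ (coord xi i) (is_derive1_sqrt t0)). Qed.

(** The speed of line i is xi_i / (2 sqrt t), and its one-sided derivatives of
    the temperature are those of the two profiles divided by sqrt t. The slope
    of a profile is the temperature increment over - gap, so that
    multiplication by k_i produces the weights of E. *)
Lemma stefan_flux_gradE i t : (1 <= i <= m)%N -> 0 < t ->
  d i * derive1 (lines xi i) t
  + k i * (profile' xi i (coord xi i) / Num.sqrt t)
  - k i.-1 * (profile' xi i.-1 (coord xi i) / Num.sqrt t)
  = gradE i xi / Num.sqrt t.
Proof.
case: i => // i im t0; have s0 : Num.sqrt t != 0 by rewrite gt_eqF// sqrtr_gt0.
rewrite derive1E; have [_ ->] := is_derive_lines i.+1 t0.
have g1 : gap i.+1 xi != 0 by rewrite gt_eqF ?gap_gt0.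
have g0 : gap i xi != 0 by rewrite gt_eqF ?gap_gt0// ltnW.
have a1 : a i.+1 != 0 by rewrite gt_eqF ?a_gt0.
have a0 : a i != 0 by rewrite gt_eqF ?a_gt0// ltnW.
have dFa j : Fa a j (xi_ xi j.+1) - Fa a j (xi_ xi j) = - gap j xi by rewrite opprB.
rewrite /gradE /profile' /profile_slope !dFa /warm_slope /cold_slope /weight /=.
by field; rewrite s0 g1 g0 a1 a0.
Qed.

Lemma stefan_iff i t : (1 <= i <= m)%N -> 0 < t ->
  (exists ux_warm ux_cold : R,
      [/\ dx U t x @[x --> (lines xi i t)^'-] --> ux_warm,
          dx U t x @[x --> (lines xi i t)^'+] --> ux_cold &
          d i * derive1 (lines xi i) t + k i * ux_warm - k i.-1 * ux_cold = 0])
  <-> gradE i xi = 0.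
Proof.
move=> im t0; have s0 : Num.sqrt t != 0 by rewrite gt_eqF// sqrtr_gt0.
have e := stefan_flux_gradE im t0.
split=> [[w [c [cw cc h]]]|g0].
  have ew := @cvg_unique _ (@Rhausdorff R) _ _ _ _ cw (cvg_warm im t0).
  have ec := @cvg_unique _ (@Rhausdorff R) _ _ _ _ cc (cvg_cold im t0).
  move: h; rewrite ew ec e => /eqP; rewrite mulf_eq0 invr_eq0 (negPf s0) orbF.
  by move/eqP.
exists (profile' xi i (coord xi i) / Num.sqrt t).
exists (profile' xi i.-1 (coord xi i) / Num.sqrt t).
split; [exact: cvg_warm|exact: cvg_cold|].
by rewrite e g0 mul0r.
Qed.

Lemma form_initial x : 0 < x -> U t x @[t --> 0^'+] --> u 0%N.
Proof.
move=> x0.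
have cz : (fun t : R => x / Num.sqrt t : R) @ (0 : R)^'+ --> +oo.
  pose f t : R := Num.sqrt t / x.
  have f0 : \forall t \near 0^'+, 0 < f t by near=> t; rewrite divr_gt0// sqrtr_gt0.
  have cf : f t @[t --> 0^'+] --> (0 : R).
    have c : {for 0, continuous f}.
      by apply: continuousM; [exact: sqrt_continuous|exact: cst_continuous].
    by have := cvg_at_right_filter c; rewrite /f sqrtr0 mul0r.
  have h : (f t)^-1 @[t --> 0^'+] --> +oo := (cvgrVy f0).2 cf.
  have -> : (fun t : R => x / Num.sqrt t : R) = (fun t => (f t)^-1).
    by apply/funext => t; rewrite /f invf_div.
  exact: h.
have c0 : profile xi 0 z @[z --> +oo] --> u 0%N.
  have h : (z / a 0%N : R) @[z --> +oo] --> +oo.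
    by apply: gt0_cvgMly; [rewrite invr_gt0 a_gt0|exact: cvg_id].
  have hF : F (z / a 0%N)%:E @[z --> +oo] --> (1 : R) := cvg_comp _ _ h (@F_cvg1 R).
  rewrite -[X in _ --> X](_ : u 0%N + profile_slope xi 0 * (1 - Fa a 0 (xi_ xi 0)) = _).
    apply: cvgD; first exact: cvg_cst.
    by apply: cvgM; [exact: cvg_cst|apply: cvgB => //; exact: cvg_cst].
  by rewrite xi_0 Fa_oo// subrr mulr0 addr0.
suff : (fun t : R => U t x : R) @ (0 : R)^'+ --> u 0%N by [].
apply: cvg_trans (cvg_comp _ _ cz c0); apply: near_eq_cvg.
have near_oo : \forall t \near (0 : R)^'+, coord xi 1 < x / Num.sqrt t :=
  cz _ (nbhs_pinfty_gt (num_real _)).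
apply: filterS near_oo => t zt; rewrite /= /U (@form_profile 0)//.
by apply/in_phaseP => //; split=> //; left.
Unshelve. all: by end_near. Qed.

Lemma form_boundary t : 0 < t -> U t x @[x --> 0^'+] --> u m.+1.
Proof.
move=> t0; have s0 : 0 < Num.sqrt t by rewrite sqrtr_gt0.
have c : {for 0, continuous (fun x => profile xi m (x / Num.sqrt t))}.
  apply: (@continuous_comp _ _ _ (fun y => y / Num.sqrt t)).
    by apply: continuousM; [exact: cvg_id|exact: cst_continuous].
  exact: is_derive_continuous (is_derive_profile _ _ _).
have := cvg_at_right_filter c.
have -> : profile xi m (0 / Num.sqrt t) = u m.+1.
  have g0 : gap m xi != 0 by rewrite gt_eqF ?gap_gt0.
  rewrite mul0r /profile /profile_slope (xi_E xi (i := m.+1)) ?leqnn// coord_last.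
  have e : Fa a m 0%:E - Fa a m (xi_ xi m) = - gap m xi.
    by rewrite opprB /gap (xi_E xi (i := m.+1)) ?leqnn// coord_last.
  by rewrite e divfK ?oppr_eq0// addrC subrK.
apply: cvg_trans; apply: near_eq_cvg; near=> x.
rewrite /U (@form_profile m)//; apply/in_phaseP => //; rewrite coord_last.
split; first by rewrite divr_gt0.
right; rewrite ltr_pdivrMr//; near: x; apply: nbhs_right_lt.
by rewrite mulr_gt0// (Omega_gt0 xO)// m_ge1 leqnn.
Unshelve. all: by end_near. Qed.

(** As u is nondecreasing, the temperatures strictly between u_i and u_(i+1)
    are taken neither on the lines nor in the other phases. *)
Lemma form_heat_region i t x : (i <= m)%N -> 0 < t -> 0 < x ->
  u i < U t x < u i.+1 -> in_phase xi i (x / Num.sqrt t).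
Proof.
move=> im t0 x0 /andP[h1 h2].
have z0 : 0 < x / Num.sqrt t by rewrite divr_gt0// sqrtr_gt0.
case: (in_phase_or_line xi z0) => -[j jm]; last first.
  move=> zj; move: h1 h2; rewrite /U zj vf.2//; case/andP: jm => j1 jm.
  have [ji|ij] := leqP j i.
    by rewrite ltNge u_le// ji (leqW im).
  by move=> _; rewrite ltNge u_le// ij (leqW jm).
move=> zj; have /andP[v1 v2] := form_le jm zj.
have [ij|ji|->//] := ltngtP i j.
  have uu : u i.+1 <= u j by rewrite u_le// ij (leqW jm).
  by move: h2; rewrite ltNge (le_trans uu v1).
have uu : u j.+1 <= u i by rewrite u_le// ji (leqW im).
by move: h1; rewrite ltNge (le_trans v2 uu).
Qed.

(** All conditions but two follow from the form of v: continuity across the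
    lines, which a global formula for v makes evident, and the Stefan
    conditions, which amount to grad E = 0. *)
Lemma critical_Stefan_Dirichlet :
  (forall z, 0 < z -> {for z, continuous v}) ->
  (forall i, (1 <= i <= m)%N -> gradE i xi = 0) ->
  Stefan_Dirichlet m u a k d U (lines xi).
Proof.
move=> cv g0; split.
- move=> i t im t0; have s0 : 0 < Num.sqrt t by rewrite sqrtr_gt0.
  rewrite /ext /lines /= im; case: ltnP => mi.
    case: eqP => [_|/eqP i0]; first by rewrite ltry.
    by rewrite lte_fin ltr_pM2r// ((OmegaP xi).1 xO)// lt0n i0.
  have -> : i = m by apply/eqP; rewrite eqn_leq im.
  case: eqP => [_|/eqP i0]; first by rewrite ltry.
  rewrite lte_fin mulr_gt0//.
  by rewrite (Omega_gt0 xO)// lt0n i0 leqnn.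
- move=> i t im t0; have s0 : Num.sqrt t != 0 by rewrite gt_eqF// sqrtr_gt0.
  split; first by have [] := is_derive_lines i t0.
  by rewrite /U /lines mulfK// vf.2.
- by move=> i p im /(phaseP _ _ im)[p0 pi]; exact: form_bounds.
- move=> p [p1 p2].
  apply: (@continuous_comp _ _ _ (fun q : R * R => q.2 / Num.sqrt q.1) v).
    exact: continuous_similarity.
  by apply: cv; rewrite divr_gt0// sqrtr_gt0.
- exact: form_smooth.
- by move=> i t x im t0 x0 h; apply: form_heat => //; exact: form_heat_region.
- by move=> i t im t0; apply/stefan_iff => //; exact: g0.
- exact: form_initial.
- exact: form_boundary.
Qed.

End Form.

(** * Existence: a continuous function of the prescribed form *)

Section Temperature.
Variables (xi : 'rV[R]_m) (xO : Omega xi).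

Definition fraction i z : R := (Fa a i (xi_ xi i) - Fa a i z%:E) / gap i xi.

(** A single formula for all phases: phase i contributes the fraction of its
    temperature increment that is gained between its cold end and z, namely
    nothing if z lies on its cold side and everything if z lies on its warm
    side. This expression is visibly continuous, also across the lines. *)
Definition temperature z : R :=
  u 0%N + \sum_(0 <= i < m.+1) (u i.+1 - u i) * Num.min 1 (Num.max 0 (fraction i z)).

Lemma xi_le i j : (i <= j <= m.+1)%N -> (xi_ xi j <= xi_ xi i)%E.
Proof.
case/andP; elim: j => [|j IH]; first by rewrite leqn0 => /eqP->.
rewrite leq_eqVlt => /predU1P[->//|ij] jm.
apply: le_trans (IH ij (ltnW jm)).
case: j jm {IH ij} => [|j] jm; first by rewrite xi_0 leey.
by apply/ltW/xO; exact: jm.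
Qed.

Lemma xi_nNy i : xi_ xi i != -oo%E.
Proof. by rewrite /xi_ /ext; do 2?case: ifP. Qed.

Lemma temperatureE i z : (i <= m)%N -> (xi_ xi i.+1 <= z%:E <= xi_ xi i)%E ->
  temperature z = u i + (u i.+1 - u i) * fraction i z.
Proof.
move=> im /andP[z1 z2]; have gap0 j : (j <= m)%N -> 0 < gap j xi by exact: gap_gt0.
rewrite /temperature (@big_cat_nat _ _ _ i)//=; last exact: leqW.
rewrite (eq_big_nat _ _ (F2 := fun j => u j.+1 - u j)); last first.
  move=> j /andP[_ ji]; have jm : (j <= m)%N by rewrite (leq_trans (ltnW ji)).
  rewrite -[RHS]mulr1; congr (_ * _).
  have f1 : 1 <= fraction j z.
    rewrite /fraction ler_pdivlMr ?gap0// mul1r lerD2l lerN2 Fa_le//.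
    by rewrite (le_trans z2)// xi_le// ji (leqW im).
  by rewrite (elimT max_idPr) ?(le_trans ler01 f1)// (elimT min_idPl).
rewrite telescope_sumr// big_ltn//= [X in _ + (_ + X)]big1_seq ?addr0; last first.
  move=> j; rewrite /= mem_index_iota => /andP[ij jm].
  have f0 : fraction j z <= 0.
    rewrite /fraction pmulr_lle0 ?invr_gt0 ?gap0// subr_le0 Fa_le ?xi_nNy//.
    by apply: le_trans z1; rewrite xi_le// ij ltnW.
  by rewrite (elimT max_idPl)// (elimT min_idPr) ?mulr0.
rewrite addrA [u 0%N + _]addrC subrK; congr (_ + _ * _).
have f0 : 0 <= fraction i z.
  by rewrite divr_ge0 ?(ltW (gap0 _ _))// subr_ge0 Fa_le.
have f1 : fraction i z <= 1.
  rewrite /fraction ler_pdivrMr ?gap0// mul1r lerD2l lerN2 Fa_le//.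
  exact: xi_nNy.
by rewrite (elimT max_idPr)// (elimT min_idPr).
Qed.

Lemma temperature_form : selfsimilar_form u a xi temperature.
Proof.
split=> [i z im /andP[z1 z2]|i im].
  rewrite (@temperatureE i)//; last by rewrite !ltW.
  have g0 : gap i xi != 0 by rewrite gt_eqF ?gap_gt0.
  have e : Fa a i (xi_ xi i.+1) - Fa a i (xi_ xi i) = - gap i xi by rewrite opprB.
  by rewrite e /fraction; field.
have /andP[i1 im'] := im.
have zE : (coord xi i)%:E = xi_ xi i by rewrite xi_E// i1 leqW.
rewrite (@temperatureE i)//.
  by rewrite /fraction zE subrr mul0r mulr0 addr0.
by rewrite zE lexx andbT xi_le// leqnSn ltnS.
Qed.

Lemma continuous_temperature : continuous temperature.
Proof.
move=> z; have cf i : {for z, continuous (fraction i)}.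
  apply: continuousM; last exact: cst_continuous.
  have h : {for z, continuous (fun w : R => w / a i)}.
    by apply: continuousM; [exact: cvg_id|exact: cst_continuous].
  apply: continuousB; first exact: cst_continuous.
  exact: (@continuous_comp _ _ _ (fun w => w / a i) (fun w => F w%:E)) h (@continuous_F R _).
rewrite /temperature; under eq_fun do rewrite big_mkord.
apply: continuousD; first exact: cst_continuous.
apply: continuous_sum_at => i.
apply: continuousM; first exact: cst_continuous.
apply: continuous_min; first exact: cst_continuous.
by apply: continuous_max; [exact: cst_continuous|exact: cf].
Qed.

End Temperature.
End SelfSimilar.
End StefanProblem.

(** * The theorem *)

Unset Implicit Arguments.

Theorem theorem1p2 (R : realType) (m : nat) (u a k d : nat -> R)
    (m_ge1 : (1 <= m)%N)
    (u01 : u 0%N <= u 1%N)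
    (u_incr : forall i, (1 <= i <= m)%N -> u i < u i.+1)
    (a_gt0 : forall i, (i <= m)%N -> 0 < a i)
    (k_gt0 : forall i, (i <= m)%N -> 0 < k i)
    (d_ge0 : forall i, (1 <= i <= m)%N -> 0 <= d i)
    (d1_gt0 : u 0%N = u 1%N -> 0 < d 1%N) :
  strictly_convex_on (@Omega R m) (E u a k d) /\
  coercive_on (@Omega R m) (E u a k d) /\
  exists (xi : 'rV[R]_m) (v : R -> R),
    [/\ selfsimilar_solution u a k d xi v,
        forall (xi' : 'rV[R]_m) (v' : R -> R),
          selfsimilar_solution u a k d xi' v' ->
          xi' = xi /\ (forall z : R, 0 < z -> v' z = v z) &
        forall eta : 'rV[R]_m, Omega eta -> eta != xi ->
          E u a k d xi < E u a k d eta].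
Proof.
split; first exact: strictly_convex_E.
split; first exact: coercive_E.
have [xi xO xmin] : exists2 xi : 'rV[R]_m, Omega xi &
    forall y : 'rV[R]_m, Omega y -> E u a k d xi <= E u a k d y by exact: E_has_min.
have g0 i : (1 <= i <= m)%N -> gradE u a k d i xi = 0 by exact: min_critical.
have vf := temperature_form u a_gt0 xO.
exists xi, (temperature u a xi); split.
- split=> //; apply: critical_Stefan_Dirichlet => // z _; exact: continuous_temperature.
- move=> xi' v' [xO' vf' sd].
  have g0' i : (1 <= i <= m)%N -> gradE u a k d i xi' = 0.
    move=> im; apply/(stefan_iff k d a_gt0 xO' vf' im ltr01).
    exact: SD_stefan sd i 1 im ltr01.
  (* Two distinct critical points would each lie strictly below the other. *)
  have xixi' : xi' = xi.
    apply/eqP/negPn/negP => neq.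
    have := critical_lt u01 u_incr a_gt0 k_gt0 d_ge0 xO g0 xO' neq.
    rewrite eq_sym in neq.
    by rewrite ltNge ltW// (critical_lt u01 u_incr a_gt0 k_gt0 d_ge0 xO' g0').
  split=> // z z0; subst xi'.
  case: (in_phase_or_line xi z0) => -[i im zi].
    by rewrite (vf'.1 _ _ im zi) (vf.1 _ _ im zi).
  by rewrite zi (vf'.2 _ im) (vf.2 _ im).
- by move=> eta eO neq; exact: critical_lt.
Qed.
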